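(* There is an algorithm which, given a CTMC $\mathcal{C}=(S,Q,L)$ with $n=|S|$ states whose fanout $\max_{s\in S}|\mathrm{post}(s)|$ is bounded by a constant, computes the weak simulation preorder $\preceq^w_{\mathcal{C}}$ in time $O(n^4)$.
   Context: A CTMC is $\mathcal{C}=(S,Q,L)$ with $S$ finite, $L:S\to2^{AP}$ and rate matrix $Q:S\times S\to\mathbb{R}_{\ge0}$; $Q(s,X)=\sum_{t\in X}Q(s,t)$, $\mathrm{post}(s)=\{t:Q(s,t)>0\}$; embedded probabilities $\mathbf{P}(s,t)=Q(s,t)/Q(s,S)$ if $Q(s,S)>0$, else $0$. For $R\subseteq S\times S$, $s_1\sqsubseteq^w_Rs_2$ iff there are $\delta_1,\delta_2:S\to[0,1]$ such that, with $U_i=\{u\in\mathrm{post}(s_i):\delta_i(u)>0\}$, $V_i=\{v\in\mathrm{post}(s_i):\delta_i(v)<1\}$, $K_i=\sum_{u\in U_i}\delta_i(u)\mathbf{P}(s_i,u)$: (1) $(v,s_2)\in R$ for $v\in V_1$, $(s_1,v)\in R$ for $v\in V_2$; (2) there is $\Delta:S\times S\to[0,1]$ with (a) $\Delta(u_1,u_2)>0\Rightarrow u_1\in U_1,u_2\in U_2,(u_1,u_2)\in R$, (b) if $K_1,K_2>0$ then for all $w$: $K_1\sum_{u\in U_2}\Delta(w,u)=\mathbf{P}(s_1,w)\delta_1(w)$ and $K_2\sum_{u\in U_1}\Delta(u,w)=\mathbf{P}(s_2,w)\delta_2(w)$; (3') $K_1Q(s_1,S)\le K_2Q(s_2,S)$.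 A weak simulation on $\mathcal{C}$ is $R$ such that every $(s_1,s_2)\in R$ has $L(s_1)=L(s_2)$ and $s_1\sqsubseteq^w_Rs_2$; $s_1\preceq^w_{\mathcal{C}}s_2$ iff some weak simulation contains $(s_1,s_2)$. Arithmetic on reals is counted at unit cost. *)

(* Defs.v *)
From HB Require Import structures.
From mathcomp Require Import all_boot all_order all_algebra.
From mathcomp Require Import all_classical all_reals all_analysis.

Set Implicit Arguments.
Unset Strict Implicit.
Unset Printing Implicit Defensive.

Import Order.TTheory GRing.Theory Num.Theory.
Local Open Scope ring_scope.

Record ctmc (R : realType) (AP S : finType) := CTMC {
  rate : S -> S -> R;
  rate_ge0 : forall s t, 0 <= rate s t;
  label : S -> {set AP} }.

Section WeakSimulation.
Variables (R : realType) (AP S : finType) (M : ctmc R AP S).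
Implicit Types (s t u v w : S) (Rel : {set S * S}) (d : S -> R).

Definition rate_to s (X : {set S}) : R := \sum_(t in X) rate M s t.

Definition exit_rate s : R := rate_to s [set: S].

Definition post s : {set S} := [set t | 0 < rate M s t].

Definition embedded s t : R :=
  if 0 < exit_rate s then rate M s t / exit_rate s else 0.

Definition fanout : nat := \max_(s : S) #|post s|.

Definition Upart d s : {set S} := [set u in post s | 0 < d u].
Definition Vpart d s : {set S} := [set v in post s | d v < 1].
Definition Kpart d s : R := \sum_(u in Upart d s) d u * embedded s u.

Definition weak_step Rel s1 s2 : Prop :=
  exists d1 d2 : S -> R,
    let U1 := Upart d1 s1 in let U2 := Upart d2 s2 in
    let V1 := Vpart d1 s1 in let V2 := Vpart d2 s2 in
    let K1 := Kpart d1 s1 in let K2 := Kpart d2 s2 in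
    [/\ (forall u, 0 <= d1 u <= 1) /\ (forall u, 0 <= d2 u <= 1),
        (forall v, v \in V1 -> (v, s2) \in Rel) /\
        (forall v, v \in V2 -> (s1, v) \in Rel),
        exists D : S -> S -> R,
          [/\ forall u1 u2, 0 <= D u1 u2 <= 1,
              forall u1 u2, 0 < D u1 u2 ->
                [/\ u1 \in U1, u2 \in U2 & (u1, u2) \in Rel] &
              0 < K1 -> 0 < K2 -> forall w,
                K1 * (\sum_(u in U2) D w u) = embedded s1 w * d1 w /\
                K2 * (\sum_(u in U1) D u w) = embedded s2 w * d2 w] &
        K1 * exit_rate s1 <= K2 * exit_rate s2].

Definition weak_simulation Rel : Prop :=
  forall s1 s2, (s1, s2) \in Rel ->
    label M s1 = label M s2 /\ weak_step Rel s1 s2.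

Definition weakly_simulated s1 s2 : Prop :=
  exists Rel, weak_simulation Rel /\ (s1, s2) \in Rel.

End WeakSimulation.

(** A program works on finitely many unbounded arrays of naturals and of reals
  (those named in its text); array [a] has cells [imem st a 0, imem st a 1, ...]
  (resp. [rmem]), and a scalar variable is cell [0] of an array. Naturals serve
  as addresses and counters. There are no real constants besides the naturals
  and no conversion of reals to naturals, so no rounding. Every constant,
  memory access, arithmetic operation, comparison, connective, assignment and
  branch has unit cost. *)

Record store (R : Type) := Store {
  imem : nat -> nat -> nat;
  rmem : nat -> nat -> R }.

Inductive iexpr :=
| INum of nat
| IGet of nat & iexpr
| IAdd of iexpr & iexpr
| ISub of iexpr & iexpr
| IMul of iexpr & iexpr.

Inductive rexpr :=
| RNum of nat
| RGet of nat & iexpr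
| RAdd of rexpr & rexpr
| RSub of rexpr & rexpr
| RMul of rexpr & rexpr
| RDiv of rexpr & rexpr.

Inductive bexpr :=
| BIle of iexpr & iexpr
| BRle of rexpr & rexpr
| BNot of bexpr
| BAnd of bexpr & bexpr.

Inductive cmd :=
| Skip
| ISet of nat & iexpr & iexpr
| RSet of nat & iexpr & rexpr
| Seq of cmd & cmd
| If of bexpr & cmd & cmd
| While of bexpr & cmd.

Section Semantics.
Variable R : realType.
Implicit Types st : store R.

Fixpoint ieval st (e : iexpr) : nat :=
  match e with
  | INum k => k
  | IGet a e1 => imem st a (ieval st e1)
  | IAdd e1 e2 => (ieval st e1 + ieval st e2)%N
  | ISub e1 e2 => (ieval st e1 - ieval st e2)%N
  | IMul e1 e2 => (ieval st e1 * ieval st e2)%N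
  end.

Fixpoint reval st (e : rexpr) : R :=
  match e with
  | RNum k => k%:R
  | RGet a e1 => rmem st a (ieval st e1)
  | RAdd e1 e2 => reval st e1 + reval st e2
  | RSub e1 e2 => reval st e1 - reval st e2
  | RMul e1 e2 => reval st e1 * reval st e2
  | RDiv e1 e2 => reval st e1 / reval st e2
  end.

Fixpoint beval st (b : bexpr) : bool :=
  match b with
  | BIle e1 e2 => (ieval st e1 <= ieval st e2)%N
  | BRle e1 e2 => reval st e1 <= reval st e2
  | BNot b1 => ~~ beval st b1
  | BAnd b1 b2 => beval st b1 && beval st b2
  end.

Definition upd (T : Type) (m : nat -> nat -> T) (a i : nat) (x : T) :=
  fun a' i' => if (a' == a) && (i' == i) then x else m a' i'.

Definition iset st a i x := Store (upd (imem st) a i x) (rmem st).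
Definition rset st a i x := Store (imem st) (upd (rmem st) a i x).

End Semantics.

Fixpoint icost (e : iexpr) : nat :=
  match e with
  | INum _ => 1
  | IGet _ e1 => (icost e1).+1
  | IAdd e1 e2 | ISub e1 e2 | IMul e1 e2 => (icost e1 + icost e2).+1
  end.

Fixpoint rcost (e : rexpr) : nat :=
  match e with
  | RNum _ => 1
  | RGet _ e1 => (icost e1).+1
  | RAdd e1 e2 | RSub e1 e2 | RMul e1 e2 | RDiv e1 e2 =>
      (rcost e1 + rcost e2).+1
  end.

Fixpoint bcost (b : bexpr) : nat :=
  match b with
  | BIle e1 e2 => (icost e1 + icost e2).+1
  | BRle e1 e2 => (rcost e1 + rcost e2).+1
  | BNot b1 => (bcost b1).+1
  | BAnd b1 b2 => (bcost b1 + bcost b2).+1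
  end.

(** [exec c st t st']: started in [st], the program [c] halts in [st'] after
    [t] unit-cost operations. *)
Inductive exec (R : realType) : cmd -> store R -> nat -> store R -> Prop :=
| ExecSkip st : exec Skip st 1 st
| ExecISet st a i e :
    exec (ISet a i e) st (icost i + icost e).+1
         (iset st a (ieval st i) (ieval st e))
| ExecRSet st a i e :
    exec (RSet a i e) st (icost i + rcost e).+1
         (rset st a (ieval st i) (reval st e))
| ExecSeq c1 c2 st1 st2 st3 t1 t2 :
    exec c1 st1 t1 st2 -> exec c2 st2 t2 st3 ->
    exec (Seq c1 c2) st1 (t1 + t2) st3
| ExecIfTrue b c1 c2 st st' t :
    beval st b -> exec c1 st t st' ->
    exec (If b c1 c2) st (bcost b + t).+1 st'
| ExecIfFalse b c1 c2 st st' t :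
    ~~ beval st b -> exec c2 st t st' ->
    exec (If b c1 c2) st (bcost b + t).+1 st'
| ExecWhileFalse b c st :
    ~~ beval st b -> exec (While b c) st (bcost b).+1 st
| ExecWhileTrue b c st1 st2 st3 t1 t2 :
    beval st1 b -> exec c st1 t1 st2 -> exec (While b c) st2 t2 st3 ->
    exec (While b c) st1 (bcost b + t1 + t2).+1 st3.

(** States and atomic propositions are numbered by [enum_rank]; tables are
  stored row by row. All cells not mentioned are arbitrary, so an algorithm
  may not rely on their initial contents. *)

Section Encoding.
Variables (R : realType) (AP S : finType) (M : ctmc R AP S) (st : store R).

Definition encodes_ctmc : Prop :=
  [/\ imem st 0 0 = #|S|,
      imem st 0 1 = #|AP|,
      forall (s : S) (a : AP),
        imem st 1 (enum_rank s * #|AP| + enum_rank a)%N = (a \in label M s) &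
      forall s t : S,
        rmem st 0 (enum_rank s * #|S| + enum_rank t)%N = rate M s t].

Definition encodes_preorder : Prop :=
  forall s t : S,
    imem st 2 (enum_rank s * #|S| + enum_rank t)%N
      = `[< weakly_simulated M s t >].

End Encoding.

(* Main.v *)
(** A weak simulation step for [(s1, s2)] amounts to a scaling factor [lam] in
  [0, 1] (the ratio of the total rates of the non-stuttering parts) together
  with a transport plan supported on [Rel] whose row sums lie between the pinned
  and the full rates of [s1], and whose column sums lie between [lam] times those
  of [s2]. Hoffman's circulation theorem turns the existence of the plan into
  Hall-type inequalities, each giving a lower or an upper bound on [lam];
  eliminating [lam] leaves the inequalities [subset_test] over all pairs of
  subsets of [post s1] and [post s2], whose number is bounded in terms of the
  fanout.

  The algorithm starts from equality of labels and makes [n ^ 2] passes over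
  all pairs of states, deleting at once each pair that fails the test. Every
  pass that starts above the preorder deletes a pair, and there are at most
  [n ^ 2] pairs. *)

Require Import Defs.
From mathcomp Require Import all_boot all_order all_algebra.
From mathcomp Require Import all_classical all_reals all_analysis.
From mathcomp Require Import zify ring lra.

Set Implicit Arguments.
Unset Strict Implicit.
Unset Printing Implicit Defensive.

Import Order.TTheory GRing.Theory Num.Theory.
Local Open Scope ring_scope.

(** * Circulations and bipartite flows *)

(** The factor [lam] can be eliminated because an interval is nonempty exactly when each lower bound
    is at most each upper bound. The lower bounds come from subsets [A] of one side and the upper
    bounds from subsets [B] of the other, so comparing them two at a time suffices. Row sums and
    column sums are bounded from below and from above at once, which calls for circulations with
    lower bounds on arcs rather than for the marriage theorem. On the machine side the obstacle is
    uniformity. One program serves all fanout bounds [k], so it must compute the range of its subset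
    loops itself; and the constants in the running times must be fixed before the chain is given,
    whence the form [exists C, forall S M ...] of the execution lemmas. Testing one pair costs a
    constant depending only on [k] (at most [4 ^ k] pairs of masks), so [n ^ 2] passes over [n ^ 2]
    pairs yield the exponent 4. Deleting a pair at once, in the middle of a pass, is safe since weak
    steps are monotone in the relation. *)

Section Circulation.
Variables (R : realFieldType) (V : finType).
Implicit Types (lo hi f : V * V -> R) (X Y : {set V}).

Definition enters (p : V * V) X := (p.1 \notin X) && (p.2 \in X).
Definition leaves (p : V * V) X := (p.1 \in X) && (p.2 \notin X).

(** The slack of Hoffman's cut condition: the most that can flow into [X] minus the least that must
    flow out of it. *)
Definition excess lo hi X : R :=
  \sum_p (hi p *+ enters p X - lo p *+ leaves p X).

(** The arc [p] runs from [Y] minus [X] to [X] minus [Y], so it crosses neither the intersection nor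
    the union; in the submodular inequality for [excess] it leaves a surplus [hi p - lo p]. Hence
    lower and upper demands on the value of one arc never conflict. *)
Lemma excess_crossing lo hi p X Y :
  (forall q, lo q <= hi q) -> (forall Z, 0 <= excess lo hi Z) ->
  enters p X -> leaves p Y -> hi p - excess lo hi X <= lo p + excess lo hi Y.
Proof.
move=> lohi exc0 pX pY.
suff: hi p - lo p + excess lo hi (X :&: Y) + excess lo hi (X :|: Y)
      <= excess lo hi X + excess lo hi Y.
  by have := exc0 (X :&: Y); have := exc0 (X :|: Y); lra.
have -> : hi p - lo p = \sum_q (hi q - lo q) *+ (q == p).
  by rewrite (bigD1 p) //= eqxx big1 ?addr0 // => q /negPf ->.
rewrite /excess -!big_split /=; apply: ler_sum => q _.
case: eqP => [->|_].
  move: pX pY; rewrite /enters /leaves !inE.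
  by case: (p.1 \in X); case: (p.2 \in X); case: (p.1 \in Y);
    case: (p.2 \in Y) => //= _ _; rewrite ?(mulr0n, mulr1n);
    have := lohi p; lra.
rewrite /enters /leaves !inE; have := lohi q.
by case: (q.1 \in X); case: (q.2 \in X); case: (q.1 \in Y);
  case: (q.2 \in Y) => /=; rewrite ?(mulr0n, mulr1n); lra.
Qed.

(** With equal bounds, complementing a set negates its excess, so all excesses vanish; those of
    singletons express conservation. *)
Lemma circulation_tight f :
  (forall X, 0 <= excess f f X) ->
  forall v, \sum_w f (v, w) = \sum_w f (w, v).
Proof.
move=> exc0 v.
have excC X : excess f f (~: X) = - excess f f X.
  rewrite /excess -sumrN; apply: eq_bigr => p _.
  by rewrite /enters /leaves !inE !negbK opprB.
have: excess f f [set v] = 0.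
  by apply/eqP; rewrite eq_le -oppr_ge0 -excC !exc0.
have -> : excess f f [set v] = \sum_p (f p *+ (p.2 == v) - f p *+ (p.1 == v)).
  apply: eq_bigr => p _; rewrite /enters /leaves !inE.
  by case: (p.1 == v); case: (p.2 == v); rewrite /= ?subrr.
rewrite sumrB => /eqP; rewrite subr_eq0 => /eqP.
have e1 : \sum_p f p *+ (p.2 == v) = \sum_w f (w, v).
  rewrite (eq_bigr (fun p => (fun a b => f (a, b) *+ (b == v)) p.1 p.2)); last by case.
  rewrite -(pair_bigA _ (fun a b => f (a, b) *+ (b == v))) /=.
  apply: eq_bigr => a _; rewrite (bigD1 v) //= eqxx big1 ?addr0 //.
  by move=> b /negPf ->.
have e2 : \sum_p f p *+ (p.1 == v) = \sum_w f (v, w).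
  rewrite (eq_bigr (fun p => (fun a b => f (a, b) *+ (a == v)) p.1 p.2)); last by case.
  rewrite -(pair_bigA _ (fun a b => f (a, b) *+ (a == v))) /=.
  rewrite (bigD1 v) //= [X in _ + X]big1 ?addr0.
    by apply: eq_bigr => b _; rewrite eqxx.
  by move=> a /negPf ->; rewrite big1.
by rewrite e1 e2.
Qed.

(* Hoffman's circulation theorem; arcs with [lo p < hi p] are fixed one at a
   time, submodularity of [excess] leaving room for the next value. *)
Lemma circulation lo hi :
  (forall p, lo p <= hi p) -> (forall X, 0 <= excess lo hi X) ->
  exists f, (forall p, lo p <= f p <= hi p) /\
            forall v, \sum_w f (v, w) = \sum_w f (w, v).
Proof.
have [n] := ubnP #|[set p | lo p < hi p]|.
elim: n lo hi => // n IHn lo hi slack lohi exc0.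
have [/eqP tight|] := boolP ([set p | lo p < hi p] == finset.set0).
  have eqlh p : lo p = hi p.
    apply/eqP; rewrite eq_le lohi /= leNgt; apply/negP => lt_p.
    by have := finset.in_set0 p; rewrite -tight inE lt_p.
  exists lo; split=> [p|]; first by rewrite lexx lohi.
  apply: circulation_tight => X; have := exc0 X; rewrite /excess.
  by under eq_bigr do rewrite -eqlh.
case/finset.set0Pn=> p0; rewrite inE => lt_p0.
(* Fixing the arc at [x] lowers the excess of each set that it enters by [hi p0 - x]; the least
   value tolerated by all these sets is chosen. *)
pose x := \big[Num.max/lo p0]_(X | enters p0 X) (hi p0 - excess lo hi X).
have lox : lo p0 <= x by apply: bigmax_ge_id.
have xhi : x <= hi p0.
  by apply/bigmax_leP; split=> // X _; have := exc0 X; lra.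
pose fixx (g : V * V -> R) p := if p == p0 then x else g p.
have excE X : excess (fixx lo) (fixx hi) X =
    excess lo hi X + (x - hi p0) *+ enters p0 X - (x - lo p0) *+ leaves p0 X.
  rewrite /excess (bigD1 p0) //= [\sum_p _](bigD1 p0) //= /fixx eqxx.
  under eq_bigr => p /negPf -> do [].
  by rewrite !mulrnBl; ring.
have exc0x X : 0 <= excess (fixx lo) (fixx hi) X.
  rewrite excE.
  have [pX|pX] := boolP (enters p0 X).
    have -> : leaves p0 X = false.
      by move: pX; rewrite /enters /leaves => /andP[/negPf ->].
    suff: hi p0 - excess lo hi X <= x by rewrite mulr1n mulr0n; lra.
    exact: (le_bigmax_cond _ (fun Y => hi p0 - excess lo hi Y) pX).
  have [pY|_] := boolP (leaves p0 X); last by rewrite !mulr0n; have := exc0 X; lra.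
  (* A set that the arc leaves puts an upper bound on [x]; by [excess_crossing] it lies above every
     term of the maximum. *)
  suff: x <= lo p0 + excess lo hi X by rewrite mulr1n mulr0n; lra.
  apply/bigmax_leP; split; first by have := exc0 X; lra.
  by move=> Y pY'; apply: excess_crossing.
have lohix p : fixx lo p <= fixx hi p by rewrite /fixx; case: eqP.
have [|f [fb fc]] := IHn (fixx lo) (fixx hi) _ lohix exc0x.
  apply: (@leq_ltn_trans #|[set p | lo p < hi p] :\ p0|).
    apply: subset_leq_card; apply/fintype.subsetP => p.
    by rewrite !inE /fixx; case: eqP => [->|_] //=; rewrite ltxx.
  by move: slack; rewrite (cardsD1 p0) inE lt_p0 add1n ltnS.
exists f; split=> // p; have := fb p; rewrite /fixx.
by case: eqP => [-> /andP[? ?]|//]; apply/andP; split; lra.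
Qed.

End Circulation.

Lemma sum_option (R : realFieldType) (T : finType) (F : option T -> R) :
  \sum_x F x = F None + \sum_x F (Some x).
Proof.
rewrite (bigD1 None) //=; congr (_ + _).
rewrite (reindex_omap Some id) /=; last by case.
by apply: eq_bigl => x; rewrite eqxx.
Qed.

Section BipartiteFlow.
Variables (R : realFieldType) (S : finType) (E : rel S).
Variables (l1 q1 l2 q2 : S -> R).
Hypotheses (lq1 : forall u, 0 <= l1 u <= q1 u) (lq2 : forall v, 0 <= l2 v <= q2 v).
Hypothesis hall1 : forall A : {set S},
  \sum_(u in A) l1 u <= \sum_(v | [exists u in A, E u v]) q2 v.
Hypothesis hall2 : forall B : {set S},
  \sum_(v in B) l2 v <= \sum_(u | [exists v in B, E u v]) q1 u.

(* Arcs source -> left copy -> right copy -> source, the source being [None]. *)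
Let big : R := \sum_u l1 u + \sum_v l2 v.
Let lo (p : option (S + S) * option (S + S)) : R :=
  match p with
  | (None, Some (inl u)) => l1 u
  | (Some (inr v), None) => l2 v
  | _ => 0
  end.
Let hi (p : option (S + S) * option (S + S)) : R :=
  match p with
  | (None, Some (inl u)) => q1 u
  | (Some (inl u), Some (inr v)) => if E u v then big else 0
  | (Some (inr v), None) => q2 v
  | _ => 0
  end.

Let sumV (F : option (S + S) -> R) :
  \sum_x F x = F None + \sum_u F (Some (inl u)) + \sum_v F (Some (inr v)).
Proof. by rewrite sum_option big_sumType addrA. Qed.

Let l1_ge0 u : 0 <= l1 u. Proof. by case/andP: (lq1 u). Qed.
Let l2_ge0 u : 0 <= l2 u. Proof. by case/andP: (lq2 u). Qed.
Let q1_ge0 u : 0 <= q1 u. Proof. by case/andP: (lq1 u) => /le_trans; apply. Qed.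
Let q2_ge0 u : 0 <= q2 u. Proof. by case/andP: (lq2 u) => /le_trans; apply. Qed.
Let big_ge0 : 0 <= big.
Proof. by rewrite addr_ge0 ?sumr_ge0. Qed.

(** If an edge of [E] enters [X], its capacity [big] alone pays for all lower bounds. Otherwise a
    Hall condition applies: [hall1] to the left copies outside [X] if the source is in [X], and
    [hall2] to the right copies inside [X] if it is not. *)
Let bipartite_excess X : 0 <= excess lo hi X.
Proof.
have sumVV (F : option (S + S) * option (S + S) -> R) :
    \sum_p F p = F (None, None) + \sum_u F (None, Some (inl u))
      + \sum_v F (None, Some (inr v))
      + \sum_u (F (Some (inl u), None) + \sum_u' F (Some (inl u), Some (inl u'))
                + \sum_v F (Some (inl u), Some (inr v)))
      + \sum_v (F (Some (inr v), None) + \sum_u F (Some (inr v), Some (inl u))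
                + \sum_v' F (Some (inr v), Some (inr v'))).
  transitivity (\sum_x \sum_y F (x, y)).
    by rewrite pair_bigA /=; apply: eq_bigr; case.
  by rewrite !sumV; do 2?congr (_ + _); apply: eq_bigr => x _; rewrite sumV.
rewrite /excess sumrB subr_ge0 !sumVV /enters /leaves /=.
have z (b : S -> bool) : \sum_i (0 : R) *+ b i = 0.
  by apply: big1 => i _; rewrite mul0rn.
under [X in _ + X + _ <= _]eq_bigr do rewrite !z mul0rn !addr0.
under [X in _ + X <= _]eq_bigr do rewrite !z !addr0.
under [X in _ <= _ + X + _]eq_bigr do rewrite !z mul0rn !add0r.
under [X in _ <= _ + X]eq_bigr do rewrite !z !addr0.
rewrite !z !mul0rn !addr0 !add0r.
rewrite big1_eq addr0.
set cross := \sum_u \sum_v _.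
have cross_ge0 : 0 <= cross.
  by do 2!apply: sumr_ge0 => ? _; rewrite mulrn_wge0 //; case: ifP.
have crossP : big <= cross \/
    forall u v, E u v -> Some (inl u) \notin X -> Some (inr v) \notin X.
  have [/existsP[u /existsP[v /and3P[Euv uX vX]]]|/existsPn no] :=
    boolP [exists u, exists v, [&& E u v, Some (inl u) \notin X & Some (inr v) \in X]].
    left; rewrite /cross (bigD1 u) //= (bigD1 v) //= Euv uX vX mulr1n -addrA lerDl.
    by rewrite addr_ge0 //; do ?[apply: sumr_ge0 => ? _];
      rewrite mulrn_wge0 //; case: ifP.
  right=> u v Euv uX; have /existsPn/(_ v) := no u.
  by rewrite Euv uX.
have le_big (l : S -> R) (b : S -> bool) :
    (forall u, 0 <= l u) -> \sum_u l u *+ b u <= \sum_u l u.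
  by move=> l0; apply: ler_sum => u _; case: (b u) => //; rewrite mulr0n.
have ge0 (q : S -> R) (b : S -> bool) :
    (forall u, 0 <= q u) -> 0 <= \sum_u q u *+ b u.
  by move=> q0; apply: sumr_ge0 => u _; rewrite mulrn_wge0.
have sum_b (l : S -> R) (b : S -> bool) :
    \sum_u l u *+ b u = \sum_(u in [set u | b u]) l u.
  by rewrite [RHS]big_mkcond; apply: eq_bigr => u _; rewrite inE mulrb.
have zF (F : S -> R) : \sum_u F u *+ 0 = 0 by apply: big1.
have zn (F : S -> R) (b : S -> bool) : \sum_u F u *+ (b u && false) = 0.
  by apply: big1 => u _; rewrite andbF.
have [zX|zX] := boolP (None \in X) => /=.
  rewrite zn zF addr0 add0r; under [X in _ <= _ + X]eq_bigr do rewrite andbT.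
  case: crossP => [bigc|noedge].
    have := le_big _ (fun u => Some (inl u) \notin X) l1_ge0.
    have := ge0 _ (fun u => Some (inr u) \notin X) q2_ge0.
    have : 0 <= \sum_v l2 v by apply: sumr_ge0.
    by move: bigc; rewrite /big; lra.
  rewrite -[leLHS]add0r lerD // sum_b (le_trans (hall1 _)) //.
  rewrite [leLHS]big_mkcond; apply: ler_sum => v _.
  case: existsP => [[u]|_]; last by rewrite mulrn_wge0.
  by rewrite inE => /andP[uX /noedge ->].
rewrite zn zF addr0 add0r; under [X in X <= _]eq_bigr do rewrite andbT.
case: crossP => [bigc|noedge].
  have := le_big _ (fun u => Some (inr u) \in X) l2_ge0.
  have := ge0 _ (fun u => Some (inl u) \in X) q1_ge0.
  have : 0 <= \sum_v l1 v by apply: sumr_ge0.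
  by move: bigc; rewrite /big; lra.
rewrite -[leLHS]addr0 lerD // sum_b (le_trans (hall2 _)) //.
rewrite [leLHS]big_mkcond; apply: ler_sum => u _.
case: existsP => [[v]|_]; last by rewrite mulrn_wge0.
rewrite inE => /andP[vX Euv]; case: (boolP (_ \in X)) => [//|uX].
by have := noedge _ _ Euv uX; rewrite vX.
Qed.

(** The plan is the circulation on the middle arcs: conservation at a copy equates its row or column
    sum with the flow on its only arc from or to the source. *)
Lemma bipartite_flow : exists c : S -> S -> R,
  [/\ forall u v, 0 <= c u v, forall u v, ~~ E u v -> c u v = 0,
      forall u, l1 u <= \sum_v c u v <= q1 u &
      forall v, l2 v <= \sum_u c u v <= q2 v].
Proof.
have lohi p : lo p <= hi p.
  case: p => [[[u|v]|] [[u'|v']|]] //=; first by case: ifP.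
    by case/andP: (lq2 v).
  by case/andP: (lq1 u').
have [f [fb fc]] := circulation lohi bipartite_excess.
have f0 p : hi p = 0 -> 0 <= lo p -> f p = 0.
  by move=> h l; have := fb p; rewrite h; lra.
exists (fun u v => f (Some (inl u), Some (inr v))); split.
- by move=> u v; case/andP: (fb (Some (inl u), Some (inr v))).
- by move=> u v nE; apply: f0 => //=; rewrite (negPf nE).
- move=> u; have := fc (Some (inl u)); rewrite !sumV.
  rewrite (f0 (Some (inl u), None)) // [X in _ + X + _]big1 ?add0r;
    last by move=> *; apply: f0.
  rewrite [X in _ = _ + X + _]big1 ?addr0; last by move=> *; apply: f0.
  rewrite [X in _ = _ + X]big1 ?addr0; last by move=> *; apply: f0.
  by move=> ->; exact: (fb (None, Some (inl u))).
- move=> v; have := fc (Some (inr v)); rewrite !sumV.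
  rewrite (f0 (None, Some (inr v))) // [X in _ = _ + X]big1 ?addr0 ?add0r;
    last by move=> *; apply: f0.
  rewrite [X in _ + X + _ = _]big1 ?addr0; last by move=> *; apply: f0.
  rewrite [X in _ + X = _]big1 ?addr0; last by move=> *; apply: f0.
  by move=> <-; exact: (fb (Some (inr v), None)).
Qed.

End BipartiteFlow.

(** * Combinatorial criterion for a weak simulation step *)

Section Criterion.
Variables (R : realType) (AP S : finType) (M : ctmc R AP S).
Implicit Types (s t u v w : S) (r : rel S) (A B : {set S}) (d : S -> R).

(* Rate that [s] moves into [A] along states that [t] cannot match by
   stuttering. *)
Definition pinned_rate r s t A : R := \sum_(u in A | ~~ r u t) rate M s u.

Definition matching_rate r t A : R :=
  \sum_(v in post M t | [exists u in A, r u v]) rate M t v.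

Definition transp r : rel S := fun u v => r v u.

(** The first inequality says that the lower bound on [lam] given by [A] is at most 1, the second
    that it is at most the upper bound given by [B]. Cross-multiplication avoids vanishing
    denominators. *)
Definition subset_test r s t A B : bool :=
  (pinned_rate r s t A <= matching_rate r t A) &&
  (pinned_rate r s t A * pinned_rate (transp r) t s B
   <= matching_rate (transp r) s B * matching_rate r t A).

Lemma rate_notin_post s t : t \notin post M s -> rate M s t = 0.
Proof.
rewrite inE -leNgt => h; apply/eqP; rewrite eq_le h; exact: rate_ge0.
Qed.

Lemma exit_rateE s : exit_rate M s = \sum_t rate M s t.
Proof. by apply: eq_bigl => t; rewrite inE. Qed.

Lemma exit_rate_ge0 s : 0 <= exit_rate M s.
Proof. by rewrite exit_rateE sumr_ge0 // => t _; apply: rate_ge0. Qed.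

Lemma rate_le_exit s t : rate M s t <= exit_rate M s.
Proof.
rewrite exit_rateE (bigD1 t) //= lerDl sumr_ge0 // => u _; exact: rate_ge0.
Qed.

(** This covers exit rate 0 too, where all rates out of [s] vanish; from here on the argument can
    use rates instead of probabilities. *)
Lemma embeddedE s t : embedded M s t * exit_rate M s = rate M s t.
Proof.
rewrite /embedded; case: ltP => [e0|e0]; first by rewrite divfK ?gt_eqF.
rewrite mul0r; apply/eqP; rewrite eq_le rate_ge0 /=.
exact: le_trans (rate_le_exit s t) e0.
Qed.

(** Terms outside [Upart] are zero, so each side of the speed condition is a plain weighted sum of
    rates. *)
Lemma KpartE d s : (forall u, 0 <= d u) ->
  Kpart M d s * exit_rate M s = \sum_u d u * rate M s u.
Proof.
move=> d0; rewrite /Kpart mulr_suml big_mkcond; apply: eq_bigr => u _.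
rewrite !inE; case: ifPn => [_|]; first by rewrite -mulrA embeddedE.
rewrite negb_and -!leNgt => /orP[h|h].
  by rewrite rate_notin_post ?mulr0 // inE -leNgt.
by have /eqP -> : d u == 0; rewrite ?mul0r // eq_le h d0.
Qed.

Lemma Kpart_ge0 d s : (forall u, 0 <= d u) -> 0 <= Kpart M d s.
Proof.
move=> d0; apply: sumr_ge0 => u _; rewrite mulr_ge0 // /embedded.
by case: ifP => // e0; rewrite divr_ge0 ?rate_ge0 ?ltW.
Qed.

Lemma Kpart_gt0 d s u : (forall u, 0 <= d u) -> u \in Upart M d s -> 0 < Kpart M d s.
Proof.
move=> d0 uU; move: (uU); rewrite !inE => /andP[up du].
have e_gt0 : 0 < exit_rate M s by apply: lt_le_trans up (rate_le_exit s u).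
rewrite /Kpart (bigD1 u) //= ltr_wpDr //; last by rewrite mulr_gt0 // /embedded e_gt0 divr_gt0.
by apply: sumr_ge0 => v _; rewrite mulr_ge0 // /embedded e_gt0 divr_ge0 ?rate_ge0 ?ltW.
Qed.

Lemma matching_rate_ge0 r t A : 0 <= matching_rate r t A.
Proof. by apply: sumr_ge0 => u _; apply: rate_ge0. Qed.

Lemma pinned_rate_ge0 r s t A : 0 <= pinned_rate r s t A.
Proof. by apply: sumr_ge0 => u _; apply: rate_ge0. Qed.

Lemma pinned_rate_setI r s t A :
  pinned_rate r s t (A :&: post M s) = pinned_rate r s t A.
Proof.
rewrite /pinned_rate [RHS](bigID (mem (post M s))) /=.
rewrite [X in _ = _ + X]big1 => [|u /andP[_]]; last exact: rate_notin_post.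
by rewrite addr0; apply: eq_bigl => u; rewrite finset.in_setI andbAC.
Qed.

Lemma le_matching_rate r t A A' :
  A \subset A' -> matching_rate r t A <= matching_rate r t A'.
Proof.
move=> sAA'; rewrite /matching_rate [leLHS]big_mkcond [leRHS]big_mkcond.
apply: ler_sum => v _; case: (v \in _) => //=.
case: (boolP [exists u in A, _]) => [/existsP[u /andP[uA ruv]]|_].
  by rewrite (introT existsP) //; exists u; rewrite (fintype.subsetP sAA').
by case: ifP => // _; apply: rate_ge0.
Qed.

(** Intersecting with [post] keeps the pinned rates and can only lower the matching rates, so the
    tests on subsets of [post] are the strongest. *)
Lemma subset_test_post r s t :
  (forall A B, A \subset post M s -> B \subset post M t -> subset_test r s t A B) ->
  forall A B, subset_test r s t A B.
Proof.
move=> test A B.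
have := test (A :&: post M s) (B :&: post M t) (subsetIr _ _) (subsetIr _ _).
rewrite /subset_test !pinned_rate_setI => /andP[h1 h2]; apply/andP; split.
  exact: le_trans h1 (le_matching_rate _ _ (subsetIl _ _)).
by apply: le_trans h2 _; apply: ler_pM; rewrite ?matching_rate_ge0 //;
  apply: le_matching_rate (subsetIl _ _).
Qed.

(** Double counting of the mass that [D] moves out of [A]. A pinned successor is outside [Vpart], so
    [d1] is 1 there and its whole rate is transported; the mass arrives in states related to some
    member of [A]. The speed condition is absent, so that the lemma can also be applied with [s] and
    [t] exchanged. *)
Lemma pinned_le_matching r s t (K1 K2 : R) (d1 d2 : S -> R) (D : S -> S -> R) A :
  0 < K1 -> 0 < K2 -> 0 < exit_rate M t ->
  (forall u, 0 <= d1 u <= 1) -> (forall u, 0 <= d2 u <= 1) ->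
  (forall v, v \in Vpart M d1 s -> r v t) ->
  (forall u v, 0 <= D u v) ->
  (forall u v, 0 < D u v ->
    [/\ u \in Upart M d1 s, v \in Upart M d2 t & r u v]) ->
  (forall w, K1 * (\sum_(u in Upart M d2 t) D w u) = embedded M s w * d1 w) ->
  (forall w, K2 * (\sum_(u in Upart M d1 s) D u w) = embedded M t w * d2 w) ->
  pinned_rate r s t A * (K2 * exit_rate M t)
    <= matching_rate r t A * (K1 * exit_rate M s).
Proof.
move=> K1_gt0 K2_gt0 et_gt0 d1P d2P stut D_ge0 Dsupp row col.
pose U1 := Upart M d1 s; pose U2 := Upart M d2 t.
have es_ge0 := exit_rate_ge0 s.
have pin : pinned_rate r s t A
    <= exit_rate M s * K1 * \sum_(u in A) \sum_(v in U2) D u v.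
  rewrite /pinned_rate mulr_sumr big_mkcondr; apply: ler_sum => u uA.
  have rhs0 : 0 <= exit_rate M s * K1 * \sum_(v in U2) D u v.
    by rewrite mulr_ge0 ?sumr_ge0 // mulr_ge0 // ltW.
  case: ifPn => // nr; have [up|up] := boolP (u \in post M s); last first.
    by rewrite rate_notin_post.
  have d11 : d1 u = 1.
    apply/eqP; rewrite eq_le; case/andP: (d1P u) => _ -> /=.
    by rewrite leNgt; apply: contra nr => lt1; apply: stut; rewrite inE up.
  by rewrite -mulrA row d11 mulr1 mulrC embeddedE.
have mat : (\sum_(u in A) \sum_(v in U2) D u v) * (K2 * exit_rate M t)
    <= matching_rate r t A.
  rewrite exchange_big /= mulr_suml /matching_rate [leRHS]big_mkcondr.
  rewrite [leLHS]big_mkcond [leRHS]big_mkcond; apply: ler_sum => v _.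
  have [vU2|_] := boolP (v \in U2); last by do 2?case: ifP => _ //; apply: rate_ge0.
  have -> : v \in post M t by move: vU2; rewrite inE => /andP[].
  have [ex|nex] := boolP [exists u in A, r u v]; last first.
    rewrite big1 ?mul0r // => u uA; apply/eqP; rewrite eq_le D_ge0 andbT leNgt.
    apply: contra nex => /Dsupp[_ _ ruv]; apply/existsP; exists u.
    by rewrite uA.
  have -> : rate M t v = embedded M t v * exit_rate M t by rewrite embeddedE.
  rewrite mulrA ler_pM2r //.
  apply: (@le_trans _ _ (embedded M t v * d2 v)); last first.
    case/andP: (d2P v) => _ d2le; rewrite ler_piMr // /embedded.
    by case: ifP => // _; rewrite divr_ge0 ?rate_ge0 ?(ltW et_gt0).
  rewrite -col mulrC ler_pM2l // [leLHS]big_mkcond [leRHS]big_mkcond.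
  apply: ler_sum => u _; have [//|uU1] := boolP (u \in Upart M d1 s).
    by case: ifP.
  case: ifP => // _; rewrite leNgt; apply: contra uU1 => /Dsupp[].
  by [].
apply: le_trans (_ : (exit_rate M s * K1 *
    \sum_(u in A) \sum_(v in U2) D u v) * (K2 * exit_rate M t) <= _).
  by rewrite ler_wpM2r // mulr_ge0 ?ltW.
rewrite -mulrA [leRHS]mulrC [K1 * _]mulrC.
by rewrite ler_wpM2l // mulr_ge0 // ltW.
Qed.

(** In the main case [lam] is the quotient of [K1 * exit_rate s] by [K2 * exit_rate t], at most 1 by
    the speed condition. *)
Lemma weak_step_test (Rel : {set S * S}) s t :
  weak_step M Rel s t -> forall A B, subset_test (fun u v => (u, v) \in Rel) s t A B.
Proof.
set r : rel S := fun u v => _.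
case=> d1 [d2 [[d1P d2P] [stut1 stut2] [D [D01 Dsupp bal]] speed]] A B.
have d1_ge0 u : 0 <= d1 u by case/andP: (d1P u).
have d2_ge0 u : 0 <= d2 u by case/andP: (d2P u).
have D_ge0 u v : 0 <= D u v by case/andP: (D01 u v).
have e1_ge0 := exit_rate_ge0 s; have e2_ge0 := exit_rate_ge0 t.
have := Kpart_ge0 s d1_ge0; rewrite le_eqVlt => /predU1P[K10|K1_gt0].
  (* If [K1] is 0, [d1] vanishes on all successors of [s]; they all belong to [Vpart] and none is
     pinned. *)
  have pin0 : pinned_rate r s t A = 0.
    apply: big1 => u /andP[_ nr]; apply: rate_notin_post.
    apply: contra nr => up; apply: stut1; rewrite inE up /= ltNge.
    apply/negP => d1u; have := @Kpart_gt0 d1 s u d1_ge0; rewrite -K10 ltxx inE up.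
    by rewrite (lt_le_trans _ d1u) // => /(_ isT).
  by rewrite /subset_test pin0 mul0r mulr_ge0 ?matching_rate_ge0.
have e1_gt0 : 0 < exit_rate M s.
  rewrite lt_def e1_ge0 andbT; apply: contraTneq K1_gt0 => e10.
  by rewrite -leNgt /Kpart big1 // => u _; rewrite /embedded e10 ltxx mulr0.
have Ke1_gt0 : 0 < Kpart M d1 s * exit_rate M s by rewrite mulr_gt0.
(* The speed condition rules out [K2 = 0], where the balance equations would say nothing. *)
have Ke2_gt0 := lt_le_trans Ke1_gt0 speed.
have [K2_gt0 e2_gt0] : 0 < Kpart M d2 t /\ 0 < exit_rate M t.
  have := Kpart_ge0 t d2_ge0; rewrite !lt_def e2_ge0 => ->; rewrite !andbT.
  by split; apply: contraTneq Ke2_gt0 => ->; rewrite ?(mul0r, mulr0) ltxx.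
have h1 := @pinned_le_matching r s t _ _ d1 d2 D A K1_gt0 K2_gt0 e2_gt0 d1P d2P
  stut1 D_ge0 Dsupp (fun w => (bal K1_gt0 K2_gt0 w).1)
  (fun w => (bal K1_gt0 K2_gt0 w).2).
have Dsupp' u v : 0 < D v u -> [/\ u \in Upart M d2 t, v \in Upart M d1 s & transp r u v].
  by case/Dsupp.
have h2 := @pinned_le_matching (transp r) t s _ _ d2 d1 (fun u v => D v u) B
  K2_gt0 K1_gt0 e1_gt0 d2P d1P stut2 (fun u v => D_ge0 v u) Dsupp'
  (fun w => (bal K1_gt0 K2_gt0 w).2) (fun w => (bal K1_gt0 K2_gt0 w).1).
apply/andP; split.
  rewrite -(ler_pM2r Ke2_gt0); apply: le_trans h1 _.
  by rewrite ler_wpM2l ?matching_rate_ge0.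
(* The factors of the two bounds are exchanged between their sides, so they cancel in the
   product. *)
have := ler_pM _ _ h1 h2; rewrite !mulr_ge0 ?pinned_rate_ge0 ?(ltW K1_gt0)
  ?(ltW K2_gt0) // => /(_ isT isT) h.
rewrite -(@ler_pM2r _ (Kpart M d1 s * exit_rate M s * (Kpart M d2 t * exit_rate M t))) ?mulr_gt0 //.
by move: h; congr (_ <= _); ring.
Qed.

Lemma test_weak_step (Rel : {set S * S}) s t :
  (forall A B, subset_test (fun u v => (u, v) \in Rel) s t A B) -> weak_step M Rel s t.
Proof.
set r : rel S := fun u v => _ => test.
(* A zero denominator does no harm: the first part of the test then makes the numerator 0 as well.
   The largest lower bound serves as [lam]; only its maximizer has to be compared with the sets
   [B]. *)
pose ratio A := pinned_rate r s t A / matching_rate r t A.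
have [Amax _ Amax_max] := @arg_maxP _ _ _ (finset.set0 : {set S}) xpredT ratio isT.
pose lam := ratio Amax.
have lam_ge0 : 0 <= lam by rewrite divr_ge0 ?pinned_rate_ge0 ?matching_rate_ge0.
have test1 A : pinned_rate r s t A <= matching_rate r t A.
  by case/andP: (test A finset.set0).
have lam_le1 : lam <= 1.
  rewrite /lam /ratio; have := matching_rate_ge0 r t Amax.
  rewrite le_eqVlt => /predU1P[<-|m_gt0]; first by rewrite invr0 mulr0.
  by rewrite ler_pdivrMr // mul1r.
have hall1 A : pinned_rate r s t A <= lam * matching_rate r t A.
  have := matching_rate_ge0 r t A.
  rewrite le_eqVlt => /predU1P[m0|m_gt0].
    by rewrite -m0 mulr0; have := test1 A; rewrite -m0.
  by rewrite -ler_pdivrMr //; exact: Amax_max.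
have hall2 B : lam * pinned_rate (transp r) t s B <= matching_rate (transp r) s B.
  have := matching_rate_ge0 r t Amax; rewrite le_eqVlt => /predU1P[m0|m_gt0].
    by rewrite /lam /ratio -m0 invr0 mulr0 mul0r matching_rate_ge0.
  rewrite /lam /ratio mulrAC ler_pdivrMr //.
  by case/andP: (test Amax B).
(* For [lam = 0] no successor of [s] is pinned: [s] stutters on all of them and [t] on none. This
   case is separate because [d2] below divides by [lam]. *)
have := lam_ge0; rewrite le_eqVlt => /predU1P[lam0|lam_gt0].
  exists (fun=> 0), (fun=> 1).
  have K0 : Kpart M (fun=> 0) s = 0 by rewrite /Kpart big1 // => u; rewrite mul0r.
  split; rewrite ?K0 ?ltxx.
  - by split=> u; rewrite ?lexx ?ler01.
  - split=> v; last by rewrite !inE ltxx andbF.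
    rewrite inE => /andP[vp _]; apply/negPn/negP => nr.
    have := hall1 [set v]%SET; rewrite -lam0 mul0r /pinned_rate.
    rewrite (big_pred1 v) => [|u]; last first.
      by rewrite inE /=; case: eqP => // ->; rewrite /r nr.
    by rewrite leNgt; move: vp; rewrite inE => ->.
  - by exists (fun _ _ => 0); split=> [u v|u v|]; rewrite ?lexx ?ler01 ?ltxx.
  - by rewrite mul0r mulr_ge0 ?exit_rate_ge0 ?Kpart_ge0.
pose E : rel S := fun u v => [&& u \in post M s, v \in post M t & r u v].
(* Pinned states must send their full rate; this will force [d1 u = 1] there, hence the stuttering
   condition. *)
pose l1 u := if r u t then 0 else rate M s u.
pose l2 v := lam * if r s v then 0 else rate M t v.
pose q2 v := lam * rate M t v.
have lq1 u : 0 <= l1 u <= rate M s u.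
  by rewrite /l1; case: ifP; rewrite ?lexx ?rate_ge0.
have lq2 v : 0 <= l2 v <= q2 v.
  by rewrite /l2 /q2; case: ifP => _; rewrite ?mulr0 ?lexx ?andbT /= mulr_ge0 ?rate_ge0.
have hallE1 A : \sum_(u in A) l1 u <= \sum_(v | [exists u in A, E u v]) q2 v.
  have -> : \sum_(u in A) l1 u = pinned_rate r s t A.
    rewrite /pinned_rate [RHS]big_mkcondr; apply: eq_bigr => u _.
    by rewrite /l1; case: (r u t).
  rewrite -pinned_rate_setI (le_trans (hall1 _)) // -mulr_sumr ler_wpM2l //.
  rewrite le_eqVlt; apply/orP; left; apply/eqP; apply: eq_bigl => v.
  apply/idP/idP => [/andP[vp /existsP[u]]|/existsP[u]].
    rewrite finset.in_setI => /andP[/andP[uA up] ruv].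
    by apply/existsP; exists u; rewrite uA /E up vp.
  case/andP=> uA /and3P[up vp ruv]; rewrite vp; apply/existsP; exists u.
  by rewrite finset.in_setI uA up.
have hallE2 B : \sum_(v in B) l2 v <= \sum_(u | [exists v in B, E u v]) rate M s u.
  have -> : \sum_(v in B) l2 v = lam * pinned_rate (transp r) t s B.
    rewrite -mulr_sumr; congr (_ * _); rewrite /pinned_rate [RHS]big_mkcondr.
    by apply: eq_bigr => v _; rewrite /transp; case: (r s v).
  rewrite -pinned_rate_setI (le_trans (hall2 _)) //.
  rewrite le_eqVlt; apply/orP; left; apply/eqP; apply: eq_bigl => u.
  apply/idP/idP => [/andP[up /existsP[v]]|/existsP[v]].
    rewrite finset.in_setI => /andP[/andP[vB vp] ruv].
    by apply/existsP; exists v; rewrite vB /E up vp.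
  case/andP=> vB /and3P[up vp ruv]; rewrite up; apply/existsP; exists v.
  by rewrite finset.in_setI vB vp.
have [c [c_ge0 cE row col]] := bipartite_flow lq1 lq2 hallE1 hallE2.
pose rowsum u := \sum_v c u v; pose colsum v := \sum_u c u v.
have row_ge0 u : 0 <= rowsum u by apply: sumr_ge0.
have col_ge0 v : 0 <= colsum v by apply: sumr_ge0.
pose tot := \sum_u rowsum u.
have tot_col : tot = \sum_v colsum v by apply: exchange_big.
have tot_ge0 : 0 <= tot by apply: sumr_ge0.
have c_tot u v : c u v <= tot.
  rewrite /tot (bigD1 u) //= {1}/rowsum (bigD1 v) //= -addrA lerDl.
  by apply: addr_ge0; apply: sumr_ge0.
have c_supp u v : 0 < c u v -> E u v.
  by move=> cuv; apply/negPn/negP => /cE c0; rewrite c0 ltxx in cuv.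
(* The fraction of the available rate that the plan uses. Where that rate is 0 the row or column sum
   is 0 too, so the value 0 of the quotient is the right one. *)
pose d1 u := rowsum u / rate M s u; pose d2 v := colsum v / q2 v.
have q2_ge0 v : 0 <= q2 v by rewrite mulr_ge0 ?rate_ge0.
have d1rate u : d1 u * rate M s u = rowsum u.
  rewrite /d1; have [e0|nz] := eqVneq (rate M s u) 0; last by rewrite divfK.
  have /andP[_] := row u; rewrite e0 mulr0 -/(rowsum u) => h.
  by apply/eqP; rewrite eq_le row_ge0 h.
have d2rate v : d2 v * rate M t v = colsum v / lam.
  suff <- : d2 v * q2 v = colsum v by rewrite /q2; field; apply: lt0r_neq0.
  rewrite /d2; have [e0|nz] := eqVneq (q2 v) 0; last by rewrite divfK.
  have /andP[_] := col v; rewrite e0 mulr0 -/(colsum v) => h.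
  by apply/eqP; rewrite eq_le col_ge0 h.
have d1P u : 0 <= d1 u <= 1.
  rewrite divr_ge0 ?rate_ge0 //=; have [e0|nz] := eqVneq (rate M s u) 0.
    by rewrite /d1 e0 invr0 mulr0.
  by rewrite ler_pdivrMr ?lt_def ?nz ?rate_ge0 // mul1r; case/andP: (row u).
have d2P v : 0 <= d2 v <= 1.
  rewrite divr_ge0 //=; have [e0|nz] := eqVneq (q2 v) 0.
    by rewrite /d2 e0 invr0 mulr0.
  by rewrite ler_pdivrMr ?lt_def ?nz ?q2_ge0 // mul1r; case/andP: (col v).
have K1e : Kpart M d1 s * exit_rate M s = tot.
  by rewrite KpartE => [|u]; [apply: eq_bigr => u _ | case/andP: (d1P u)].
(* The two speeds are [tot] and [tot / lam], so the speed condition amounts to [lam <= 1]. *)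
have K2e : Kpart M d2 t * exit_rate M t = tot / lam.
  rewrite KpartE => [|u]; last by case/andP: (d2P u).
  by rewrite tot_col mulr_suml; apply: eq_bigr => u _.
have row_gt0 u v : 0 < c u v -> u \in Upart M d1 s.
  move=> cuv; have /and3P[up _ _] := c_supp u v cuv; rewrite inE up /=.
  rewrite divr_gt0 //; last by rewrite inE in up.
  by rewrite /rowsum (bigD1 v) //= ltr_wpDr ?sumr_ge0.
have col_gt0 u v : 0 < c u v -> v \in Upart M d2 t.
  move=> cuv; have /and3P[_ vp _] := c_supp u v cuv; rewrite inE vp /=.
  rewrite divr_gt0 //; last by rewrite inE in vp; rewrite mulr_gt0.
  by rewrite /colsum (bigD1 u) //= ltr_wpDr ?sumr_ge0.
exists d1, d2; split=> //; last first.
- rewrite K1e K2e ler_peMr //.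
  by rewrite invr_ge1 ?unitfE ?gt_eqF // lam_gt0.
(* Normalizing by the total mass turns the plan into [Delta]; for [tot = 0] the quotient is
   identically 0. *)
- exists (fun u v => c u v / tot); split=> [u v|u v|K1_gt0 K2_gt0 w].
  + rewrite divr_ge0 //=; have := tot_ge0; rewrite le_eqVlt => /predU1P[<-|tot_gt0].
      by rewrite invr0 mulr0.
    by rewrite ler_pdivrMr // mul1r.
  + move=> cuv; have {}cuv : 0 < c u v.
      rewrite lt_def c_ge0 andbT; apply: contraTneq cuv => ->.
      by rewrite mul0r ltxx.
    by split; [exact: row_gt0 cuv|exact: col_gt0 cuv|case/and3P: (c_supp u v cuv)].
  + have e1_gt0 : 0 < exit_rate M s.
      rewrite lt_def exit_rate_ge0 andbT; apply: contraTneq K1_gt0 => e10.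
      by rewrite -leNgt /Kpart big1 // => u _; rewrite /embedded e10 ltxx mulr0.
    have e2_gt0 : 0 < exit_rate M t.
      rewrite lt_def exit_rate_ge0 andbT; apply: contraTneq K2_gt0 => e20.
      by rewrite -leNgt /Kpart big1 // => u _; rewrite /embedded e20 ltxx mulr0.
    have tot_gt0 : 0 < tot by rewrite -K1e mulr_gt0.
    have -> : \sum_(u in Upart M d2 t) c w u / tot = rowsum w / tot.
      rewrite -mulr_suml; congr (_ / _); rewrite /rowsum [LHS]big_mkcond.
      apply: eq_bigr => v _; case: ifPn => // vU; apply/eqP.
      rewrite eq_le c_ge0 /= leNgt; apply: contra vU; exact: col_gt0.
    have -> : \sum_(u in Upart M d1 s) c u w / tot = colsum w / tot.
      rewrite -mulr_suml; congr (_ / _); rewrite /colsum [LHS]big_mkcond.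
      apply: eq_bigr => v _; case: ifPn => // vU; apply/eqP.
      rewrite eq_le c_ge0 /= leNgt; apply: contra vU; exact: row_gt0.
    rewrite /embedded e1_gt0 e2_gt0.
    split.
      rewrite -d1rate -K1e; field; rewrite !lt0r_neq0 //.
    rewrite mulrAC [_ * d2 w]mulrC d2rate.
    have -> : Kpart M d2 t = tot / lam / exit_rate M t by rewrite -K2e mulfK ?lt0r_neq0.
    by field; rewrite !lt0r_neq0.
- split=> v; rewrite inE => /andP[vp].
    apply: contraTT => nr; rewrite -leNgt.
    have /andP[] := row v; rewrite /l1 /r (negPf nr) -/(rowsum v) => h _.
    by rewrite ler_pdivlMr ?mul1r //; rewrite inE in vp.
  apply: contraTT => nr; rewrite -leNgt.
  have /andP[] := col v; rewrite /l2 /r (negPf nr) -/(colsum v) => h _.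
  by rewrite ler_pdivlMr ?mul1r //; rewrite inE in vp; rewrite mulr_gt0.
Qed.

Lemma weak_stepP (Rel : {set S * S}) s t :
  (forall A B, A \subset post M s -> B \subset post M t ->
     subset_test (fun u v => (u, v) \in Rel) s t A B) <->
  weak_step M Rel s t.
Proof.
split=> [test|/weak_step_test//].
by apply: test_weak_step; apply: subset_test_post.
Qed.

(** The relation occurs only positively, so the same witnesses serve. *)
Lemma weak_step_mono (Rel Rel' : {set S * S}) s t :
  Rel \subset Rel' -> weak_step M Rel s t -> weak_step M Rel' s t.
Proof.
move=> /fintype.subsetP sub [d1 [d2 [dP [V1 V2] [D [D01 Dsupp bal]] speed]]].
exists d1, d2; split=> //; first by split=> v; [move/V1|move/V2]; exact: sub.
by exists D; split=> // u v /Dsupp[? ? /sub].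
Qed.

(** * The preorder as the largest weak simulation *)

Definition weak_preorder : {set S * S} :=
  [set p | `[< weakly_simulated M p.1 p.2 >]]%SET.

Lemma weak_preorderP s t : reflect (weakly_simulated M s t) ((s, t) \in weak_preorder).
Proof. by rewrite inE; apply: asboolP. Qed.

Lemma weak_simulation_sub (Rel : {set S * S}) :
  weak_simulation M Rel -> Rel \subset weak_preorder.
Proof.
by move=> sim; apply/fintype.subsetP => -[s t] st; apply/weak_preorderP; exists Rel.
Qed.

Lemma weak_preorder_sim : weak_simulation M weak_preorder.
Proof.
move=> s t /weak_preorderP[Rel [sim st]]; have [lab step] := sim _ _ st.
by split=> //; apply: weak_step_mono step; apply: weak_simulation_sub.
Qed.

End Criterion.

(** * Running programs *)

Local Open Scope nat_scope.

(** A syntactic bound on the effects of a program, by arrays and not by cells; frame conditions thus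
    become membership tests on concrete numbers. *)
Fixpoint iwrites (c : cmd) : seq nat :=
  match c with
  | ISet a _ _ => [:: a]
  | Seq c1 c2 | If _ c1 c2 => iwrites c1 ++ iwrites c2
  | While _ c1 => iwrites c1
  | _ => [::]
  end.

Fixpoint rwrites (c : cmd) : seq nat :=
  match c with
  | RSet a _ _ => [:: a]
  | Seq c1 c2 | If _ c1 c2 => rwrites c1 ++ rwrites c2
  | While _ c1 => rwrites c1
  | _ => [::]
  end.

Definition ivar (a : nat) : iexpr := IGet a (INum 0).

(* The bound of the loop is the cell [b]`_[c]. *)
Definition For (i b c : nat) (body : cmd) : cmd :=
  Seq (ISet i (INum 0) (INum 0))
    (While (BIle (IAdd (ivar i) (INum 1)) (IGet b (INum c)))
       (Seq body (ISet i (INum 0) (IAdd (ivar i) (INum 1))))).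

Section Runs.
Variable R : realType.
Implicit Types (st : store R) (c : cmd) (Q : store R -> Prop).

Definition agrees (ws rs : seq nat) st st' : Prop :=
  (forall a i, a \notin ws -> imem st' a i = imem st a i) /\
  (forall a i, a \notin rs -> rmem st' a i = rmem st a i).

Lemma agrees_trans ws rs st1 st2 st3 :
  agrees ws rs st1 st2 -> agrees ws rs st2 st3 -> agrees ws rs st1 st3.
Proof. by move=> [i1 r1] [i2 r2]; split=> a i h; rewrite ?i2 ?r2 ?i1 ?r1. Qed.

Lemma agrees_sub ws rs ws' rs' st st' :
  {subset ws <= ws'} -> {subset rs <= rs'} ->
  agrees ws rs st st' -> agrees ws' rs' st st'.
Proof.
move=> sw sr [hi hr]; split=> a i; first by move/(contra (sw a)); exact: hi.
by move/(contra (sr a)); exact: hr.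
Qed.

Lemma agrees_iset ws rs st a i x : a \in ws -> agrees ws rs st (iset st a i x).
Proof.
move=> aw; split=> // a' i' a'w /=; rewrite /upd.
by case: eqP => // ea; rewrite ea aw in a'w.
Qed.

Lemma agrees_rset ws rs st a i x : a \in rs -> agrees ws rs st (rset st a i x).
Proof.
move=> aw; split=> // a' i' a'w /=; rewrite /upd.
by case: eqP => // ea; rewrite ea aw in a'w.
Qed.

Lemma exec_agrees c st t st' :
  exec c st t st' -> agrees (iwrites c) (rwrites c) st st'.
Proof.
have subl (u v : seq nat) : {subset u <= u ++ v}.
  by move=> x; rewrite mem_cat => ->.
have subr (u v : seq nat) : {subset v <= u ++ v}.
  by move=> x; rewrite mem_cat => ->; rewrite orbT.
elim=> /= {c st t st'}.
- by [].
- by move=> st a i e; apply: agrees_iset; rewrite inE.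
- by move=> st a i e; apply: agrees_rset; rewrite inE.
- move=> c1 c2 st1 st2 st3 t1 t2 _ h1 _ h2.
  by apply: (agrees_trans (agrees_sub _ _ h1) (agrees_sub _ _ h2)).
- by move=> b c1 c2 st st' t _ _; apply: agrees_sub.
- by move=> b c1 c2 st st' t _ _; apply: agrees_sub.
- by [].
- by move=> b c st1 st2 st3 t1 t2 _ _ h1 _ h2; apply: agrees_trans h2.
Qed.

(** Total correctness with an upper bound on the cost rather than its exact value, so that branches
    of different cost share one bound. *)
Definition runs (T : nat) c st Q : Prop :=
  exists t st', [/\ exec c st t st', t <= T & Q st'].

Lemma runs_agrees T c st Q :
  runs T c st Q ->
  runs T c st (fun st' => Q st' /\ agrees (iwrites c) (rwrites c) st st').
Proof.
by move=> [t [st' [ex le q]]]; exists t, st'; split=> //; split=> //; apply: exec_agrees ex.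
Qed.

Lemma runs_weaken T T' c st Q Q' :
  T <= T' -> (forall st', Q st' -> Q' st') -> runs T c st Q -> runs T' c st Q'.
Proof.
move=> leT sub [t [st' [ex le q]]]; exists t, st'; split; first exact: ex.
  exact: leq_trans le leT.
exact: sub.
Qed.

Lemma runs_skip st Q : Q st -> runs 1 Skip st Q.
Proof. by move=> q; exists 1, st; split=> //; constructor. Qed.

Lemma runs_iset st a i e Q :
  Q (iset st a (ieval st i) (ieval st e)) ->
  runs (icost i + icost e).+1 (ISet a i e) st Q.
Proof. by move=> q; eexists _, _; split; [constructor| |exact: q]. Qed.

Lemma runs_rset st a i e Q :
  Q (rset st a (ieval st i) (reval st e)) ->
  runs (icost i + rcost e).+1 (RSet a i e) st Q.
Proof. by move=> q; eexists _, _; split; [constructor| |exact: q]. Qed.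

Lemma runs_seq T1 T2 c1 c2 st P Q :
  runs T1 c1 st P ->
  (forall st', P st' -> agrees (iwrites c1) (rwrites c1) st st' -> runs T2 c2 st' Q) ->
  runs (T1 + T2) (Seq c1 c2) st Q.
Proof.
move=> [t1 [st1 [ex1 le1 p]]] h.
have [t2 [st2 [ex2 le2 q]]] := h _ p (exec_agrees ex1).
exists (t1 + t2), st2; split=> //; last exact: leq_add.
exact: ExecSeq ex1 ex2.
Qed.

Lemma runs_seq_iset T st a i e c Q :
  runs T c (iset st a (ieval st i) (ieval st e)) Q ->
  runs ((icost i + icost e).+1 + T) (Seq (ISet a i e) c) st Q.
Proof.
move=> h; apply: (runs_seq (P := eq^~ (iset st a (ieval st i) (ieval st e)))).
  exact: runs_iset.
by move=> _ ->.
Qed.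

Lemma runs_seq_rset T st a i e c Q :
  runs T c (rset st a (ieval st i) (reval st e)) Q ->
  runs ((icost i + rcost e).+1 + T) (Seq (RSet a i e) c) st Q.
Proof.
move=> h; apply: (runs_seq (P := eq^~ (rset st a (ieval st i) (reval st e)))).
  exact: runs_rset.
by move=> _ ->.
Qed.

Lemma runs_if T1 T2 b c1 c2 st Q :
  (beval st b -> runs T1 c1 st Q) -> (~~ beval st b -> runs T2 c2 st Q) ->
  runs (bcost b + maxn T1 T2).+1 (If b c1 c2) st Q.
Proof.
move=> h1 h2; have [hb|hb] := boolP (beval st b).
  have [t [st' [ex le q]]] := h1 hb; exists (bcost b + t).+1, st'; split=> //.
    exact: ExecIfTrue.
  by rewrite ltnS leq_add2l leq_max le.
have [t [st' [ex le q]]] := h2 hb; exists (bcost b + t).+1, st'; split=> //.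
  exact: ExecIfFalse.
by rewrite ltnS leq_add2l leq_max le orbT.
Qed.

Lemma runs_for (I : nat -> store R -> Prop) (N nv T i b c : nat) body st0 Q :
  nv <= N ->
  i \notin iwrites body -> b \notin i :: iwrites body -> imem st0 b c = nv ->
  I 0 (iset st0 i 0 0) ->
  (forall j st, j < nv -> I j st -> imem st i 0 = j ->
     agrees (i :: iwrites body) (rwrites body) st0 st ->
     runs T body st (fun st' => I j.+1 (iset st' i 0 j.+1))) ->
  (forall st, I nv st -> agrees (i :: iwrites body) (rwrites body) st0 st -> Q st) ->
  runs (11 + N * (T + 14)) (For i b c body) st0 Q.
Proof.
move=> nvN ib bb nvE I0 step post.
set ws := i :: iwrites body; set rs := rwrites body.
set cond := BIle (IAdd (ivar i) (INum 1)) (IGet b (INum c)).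
set loop := Seq body (ISet i (INum 0) (IAdd (ivar i) (INum 1))).
have condE j st : imem st i 0 = j -> agrees ws rs st0 st ->
    beval st cond = (j < nv).
  by move=> ij [ag _]; rewrite /= ij addn1 ag // nvE.
have main m : forall j st, j + m = nv -> I j st -> imem st i 0 = j ->
    agrees ws rs st0 st -> runs (8 + m * (T + 14)) (While cond loop) st Q.
  elim: m => [|m IHm] j st jm Ij ij ag.
    rewrite addn0 in jm; rewrite jm in ij Ij.
    exists 8, st; split=> //; last by apply: post.
    by apply: (@ExecWhileFalse _ cond); rewrite (condE nv) ?ltnn.
  have ltj : j < nv by rewrite -jm addnS ltnS leq_addr.
  have [t [st1 [ex le Ij1]]] := step _ _ ltj Ij ij ag.
  have ag1 := exec_agrees ex.
  have ij1 : imem st1 i 0 = j by rewrite ag1.1.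
  have ag2 : agrees ws rs st0 (iset st1 i 0 j.+1).
    apply: (agrees_trans ag).
    have sub : agrees ws rs st st1.
      by apply: agrees_sub ag1 => // x; rewrite inE => ->; rewrite orbT.
    by apply: (agrees_trans sub); apply: agrees_iset; rewrite inE eqxx.
  have jm1 : j.+1 + m = nv by rewrite addSnnS.
  have ij2 : imem (iset st1 i 0 j.+1) i 0 = j.+1 by rewrite /= /upd !eqxx.
  have [t2 [st2 [ex2 le2 q2]]] := IHm _ _ jm1 Ij1 ij2 ag2.
  have exl : exec loop st (t + 6) (iset st1 i 0 j.+1).
    apply: ExecSeq ex _; have -> : j.+1 = ieval st1 (IAdd (ivar i) (INum 1)).
      by rewrite /= ij1 addn1.
    exact: ExecISet.
  exists (7 + (t + 6) + t2).+1, st2; split=> //; last first.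
    by rewrite mulSn; move: le le2; set x := m * _; lia.
  by apply: (@ExecWhileTrue _ cond) exl ex2; rewrite (condE j).
have i00 : imem (iset st0 i 0 0) i 0 = 0 by rewrite /= /upd !eqxx.
have ag0 : agrees ws rs st0 (iset st0 i 0 0) by apply: agrees_iset; rewrite inE eqxx.
have [t [st' [ex le q]]] := main nv 0 _ (add0n _) I0 i00 ag0.
exists (3 + t), st'; split=> //.
  by apply: ExecSeq ex; exact: ExecISet.
have : nv * (T + 14) <= N * (T + 14) by rewrite leq_mul2r nvN orbT.
by move: le; lia.
Qed.

End Runs.

(** * The algorithm *)

(* Natural arrays: 0 sizes, 1 labels, 2 current relation, 3 out-degrees,
   4 successor lists, 5 and 6 halves and parities, 7 a power of two bounding the
   number of subsets of each [post s], 8 number of passes, 28 bits of the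
   current subset, 30 and 31 the states and 32 the subset handled by [side_cmd];
   all the others hold scalars, 21 being the verdict of [check_cmd].
   Real arrays: 0 rates, 1 and 2 results of [side_cmd], 3 and 4 copies of them. *)

Definition table_index (x y : iexpr) : iexpr := IAdd (IMul x (ivar 0)) y.
Definition rel_cell (tr : bool) (x y : iexpr) : iexpr :=
  IGet 2 (if tr then table_index y x else table_index x y).
Definition succ_cell (s i : nat) : iexpr := IGet 4 (table_index (ivar s) (ivar i)).
Definition rate_cell (x y : iexpr) : rexpr := RGet 0 (table_index x y).
Definition positive (e : iexpr) : bexpr := BIle (INum 1) e.

(** The language can neither halve a number nor take its parity, so the bits are read off the tables
    5 and 6. *)
Definition unpack_cmd : cmd :=
  Seq (ISet 24 (INum 0) (ivar 32))
    (For 16 26 0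
       (Seq (ISet 28 (ivar 16) (IGet 6 (ivar 24)))
            (ISet 24 (INum 0) (IGet 5 (ivar 24))))).

Definition pinned_cmd tr : cmd :=
  Seq (RSet 1 (INum 0) (RNum 0))
    (For 16 26 0
       (If (BAnd (positive (IGet 28 (ivar 16)))
                 (BNot (positive (rel_cell tr (succ_cell 30 16) (ivar 31)))))
           (RSet 1 (INum 0) (RAdd (RGet 1 (INum 0))
                                  (rate_cell (ivar 30) (succ_cell 30 16))))
           Skip)).

Definition matching_cmd tr : cmd :=
  Seq (RSet 2 (INum 0) (RNum 0))
    (For 17 27 0
       (Seq (ISet 25 (INum 0) (INum 0))
       (Seq (For 16 26 0
               (If (BAnd (positive (IGet 28 (ivar 16)))
                         (positive (rel_cell tr (succ_cell 30 16) (succ_cell 31 17))))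
                   (ISet 25 (INum 0) (INum 1))
                   Skip))
            (If (positive (ivar 25))
                (RSet 2 (INum 0) (RAdd (RGet 2 (INum 0))
                                       (rate_cell (ivar 31) (succ_cell 31 17))))
                Skip)))).

Definition side_cmd tr : cmd :=
  Seq (ISet 26 (INum 0) (IGet 3 (ivar 30)))
  (Seq (ISet 27 (INum 0) (IGet 3 (ivar 31)))
  (Seq unpack_cmd (Seq (pinned_cmd tr) (matching_cmd tr)))).

(** The same code computes both sides, the second with [s] and [t] exchanged and the relation
    transposed. Recomputing the first side in the inner loop costs only a constant factor. *)
Definition check_cmd : cmd :=
  Seq (ISet 21 (INum 0) (INum 1))
    (For 14 7 0 (For 15 7 0
      (Seq (ISet 30 (INum 0) (ivar 11))
      (Seq (ISet 31 (INum 0) (ivar 12))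
      (Seq (ISet 32 (INum 0) (ivar 14))
      (Seq (side_cmd false)
      (Seq (RSet 3 (INum 0) (RGet 1 (INum 0)))
      (Seq (RSet 4 (INum 0) (RGet 2 (INum 0)))
      (Seq (ISet 30 (INum 0) (ivar 12))
      (Seq (ISet 31 (INum 0) (ivar 11))
      (Seq (ISet 32 (INum 0) (ivar 15))
      (Seq (side_cmd true)
           (If (BAnd (BRle (RGet 3 (INum 0)) (RGet 4 (INum 0)))
                     (BRle (RMul (RGet 3 (INum 0)) (RGet 1 (INum 0)))
                           (RMul (RGet 2 (INum 0)) (RGet 4 (INum 0)))))
               Skip
               (ISet 21 (INum 0) (INum 0))))))))))))))).

Definition prune_cmd : cmd :=
  If (positive (IGet 2 (table_index (ivar 11) (ivar 12))))
     (Seq check_cmd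
          (If (positive (ivar 21)) Skip
              (ISet 2 (table_index (ivar 11) (ivar 12)) (INum 0))))
     Skip.

Definition pass_cmd : cmd := For 11 0 0 (For 12 0 0 prune_cmd).

Definition refine_cmd : cmd :=
  Seq (ISet 8 (INum 0) (IMul (ivar 0) (ivar 0))) (For 10 8 0 pass_cmd).

Definition label_cell (s : nat) : iexpr :=
  IGet 1 (IAdd (IMul (ivar s) (IGet 0 (INum 1))) (ivar 13)).

Definition init_cmd : cmd :=
  For 11 0 0 (For 12 0 0
    (Seq (ISet 25 (INum 0) (INum 1))
    (Seq (For 13 0 1
            (If (BAnd (BIle (label_cell 11) (label_cell 12))
                      (BIle (label_cell 12) (label_cell 11)))
                Skip
                (ISet 25 (INum 0) (INum 0))))
         (ISet 2 (table_index (ivar 11) (ivar 12)) (ivar 25))))).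

(** Cell 23 doubles at each successor found, so it ends as 2 to the out-degree; cell 7 keeps the
    maximum. The program thus needs no knowledge of [k]. *)
Definition adjacency_cmd : cmd :=
  Seq (ISet 7 (INum 0) (INum 1))
    (For 11 0 0
      (Seq (ISet 22 (INum 0) (INum 0))
      (Seq (ISet 23 (INum 0) (INum 1))
      (Seq (For 12 0 0
              (If (BRle (rate_cell (ivar 11) (ivar 12)) (RNum 0))
                  Skip
                  (Seq (ISet 4 (table_index (ivar 11) (ivar 22)) (ivar 12))
                  (Seq (ISet 22 (INum 0) (IAdd (ivar 22) (INum 1)))
                       (ISet 23 (INum 0) (IAdd (ivar 23) (ivar 23)))))))
      (Seq (ISet 3 (ivar 11) (ivar 22))
           (If (BIle (ivar 23) (ivar 7)) Skip (ISet 7 (INum 0) (ivar 23)))))))).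

(** Based on [(m + 1)./2 = m./2 + odd m] and on parity alternating. *)
Definition halving_cmd : cmd :=
  Seq (ISet 5 (INum 0) (INum 0))
  (Seq (ISet 6 (INum 0) (INum 0))
       (For 13 7 0
         (Seq (ISet 5 (IAdd (ivar 13) (INum 1)) (IAdd (IGet 5 (ivar 13)) (IGet 6 (ivar 13))))
              (ISet 6 (IAdd (ivar 13) (INum 1)) (ISub (INum 1) (IGet 6 (ivar 13))))))).

Definition simulation_cmd : cmd :=
  Seq init_cmd (Seq adjacency_cmd (Seq halving_cmd refine_cmd)).

(** * Binary masks *)

Definition bit (m i : nat) : bool := odd (iter i half m).

Lemma bits_surj d (b : nat -> bool) :
  exists2 m, m < 2 ^ d & forall i, i < d -> bit m i = b i.
Proof.
elim: d b => [|d IHd] b; first by exists 0.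
have [m ltm mb] := IHd (fun i => b i.+1).
exists (b 0 + m.*2); first by rewrite expnS mul2n; case: (b 0); lia.
case=> [|i] lti; first by rewrite /bit /= oddD odd_double addbF oddb.
by rewrite /bit iterSr half_bit_double; apply: mb.
Qed.

Lemma sum_nat_recr_cond (V : nmodType) (P : pred nat) (F : nat -> V) j :
  (\sum_(0 <= i < j.+1 | P i) F i =
   \sum_(0 <= i < j | P i) F i + (if P j then F j else 0))%R.
Proof. by rewrite big_mkcond big_nat_recr //= -big_mkcond. Qed.

Section Program.
Variables (R : realType) (AP : finType).

(** * Layout of the store *)

Definition succ_state (S : finType) (M : ctmc R AP S) s i := nth s (enum (post M s)) i.

Definition state_index (S : finType) (s t : S) : nat := enum_rank s * #|S| + enum_rank t.

(** The data prepared before refinement and left untouched by it; gathered in one predicate, they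
    pass through each command by the frame rule. *)
Record tables (S : finType) (M : ctmc R AP S) (P : nat) (st : store R) :
  Prop := Tables {
  table_size : imem st 0 0 = #|S|;
  table_rate : forall s t, rmem st 0 (state_index s t) = rate M s t;
  table_deg : forall s : S, imem st 3 (enum_rank s) = #|post M s|;
  table_succ : forall (s : S) i, i < #|post M s| ->
    imem st 4 (enum_rank s * #|S| + i) = enum_rank (succ_state M s i);
  table_half : forall m, m < P -> imem st 5 m = m./2;
  table_odd : forall m, m < P -> imem st 6 m = odd m;
  table_masks : imem st 7 0 = P;
  table_pow : forall s, 2 ^ #|post M s| <= P }.

Lemma tables_agrees (S : finType) (M : ctmc R AP S) P ws rs (st st' : store R) :
  agrees ws rs st st' -> all (fun a => a \notin ws) [:: 0; 3; 4; 5; 6; 7] ->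
  0 \notin rs -> tables M P st -> tables M P st'.
Proof.
move=> [hi hr] /and5P[w0 w3 w4 w5 /and3P[w6 w7 _]] r0 [t0 tr td ts th to tm tp].
by split=> //; intros; rewrite ?hi ?hr; auto.
Qed.

Lemma tables_iset (S : finType) (M : ctmc R AP S) P (st : store R) a i x :
  a \notin [:: 0; 3; 4; 5; 6; 7] -> tables M P st -> tables M P (iset st a i x).
Proof.
move=> aw; apply: (@tables_agrees _ _ _ [:: a] [::]) => //.
  by apply: agrees_iset; rewrite inE.
by apply/allP => b bw; rewrite inE; apply: contraNneq aw => <-.
Qed.

Lemma tables_rset (S : finType) (M : ctmc R AP S) P (st : store R) a i x :
  a != 0 -> tables M P st -> tables M P (rset st a i x).
Proof.
move=> aw; apply: (@tables_agrees _ _ _ [::] [:: a]) => //.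
  by apply: agrees_rset; rewrite inE.
by rewrite inE eq_sym.
Qed.

Definition encodes_rel (S : finType) (r : rel S) (st : store R) : Prop :=
  forall u v, imem st 2 (state_index u v) = r u v.

Lemma encodes_rel_agrees (S : finType) (r : rel S) ws rs (st st' : store R) :
  agrees ws rs st st' -> 2 \notin ws -> encodes_rel r st -> encodes_rel r st'.
Proof. by move=> [hi _] w2 h u v; rewrite hi. Qed.

Definition orient (S : finType) (tr : bool) (r : rel S) : rel S :=
  if tr then transp r else r.

Lemma rel_cellE (S : finType) (M : ctmc R AP S) P (r : rel S) tr (st : store R) x y u v :
  tables M P st -> encodes_rel r st ->
  ieval st x = enum_rank u -> ieval st y = enum_rank v ->
  ieval st (rel_cell tr x y) = orient tr r u v.
Proof.
by move=> tab rel xE yE; case: tr => /=; rewrite xE yE (table_size tab); apply: rel.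
Qed.

Lemma rate_cellE (S : finType) (M : ctmc R AP S) P (st : store R) x y u v :
  tables M P st -> ieval st x = enum_rank u -> ieval st y = enum_rank v ->
  reval st (rate_cell x y) = rate M u v.
Proof. by move=> tab /= -> ->; rewrite (table_size tab); exact: (table_rate tab). Qed.

Lemma succ_cellE (S : finType) (M : ctmc R AP S) P (st : store R) a b s i :
  tables M P st -> imem st a 0 = enum_rank s -> imem st b 0 = i -> i < #|post M s| ->
  ieval st (succ_cell a b) = enum_rank (succ_state M s i).
Proof.
by move=> tab sE iE lti; rewrite /= sE iE (table_size tab) (table_succ tab).
Qed.

Lemma positiveE (st : store R) e (b : bool) : ieval st e = b -> beval st (positive e) = b.
Proof. by move=> /= ->; rewrite lt0b. Qed.

(** * Execution of the subset test *)

Lemma unpack_runs k : exists C, forall d m P (st : store R),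
  d <= k -> m < P -> imem st 26 0 = d -> imem st 32 0 = m ->
  (forall x, x < P -> imem st 5 x = x./2) -> (forall x, x < P -> imem st 6 x = odd x) ->
  runs C unpack_cmd st (fun st' => forall i, i < d -> imem st' 28 i = bit m i).
Proof.
(* The constant stays open and is filled by the costs of the rules; its scope keeps it independent
   of the store and the mask. *)
eexists => d m P st dk mP st26 st32 halfP oddP.
apply: runs_seq_iset.
pose I j (st' : store R) := (forall i, i < j -> imem st' 28 i = bit m i) /\
  imem st' 24 0 = iter j half m.
(* Halving never leaves the range in which the tables are valid. *)
have iterP j : iter j half m < P.
  by elim: j => //= j; apply: leq_ltn_trans; rewrite -divn2 leq_div.
apply: (runs_for (I := I) dk) => //.
  move=> j st1 ltj [I1 I2] st16 [fi _].
  apply: runs_seq_iset; apply: runs_iset.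
  rewrite /I /= /upd /= !st16 !I2 !fi //= /upd /= ?halfP ?oddP //; split=> // i.
  rewrite ltnS leq_eqVlt => /predU1P[->|lti]; first by rewrite eqxx.
  by rewrite ltn_eqF // I1.
by move=> st1 [].
Qed.

Lemma pinned_runs k tr :
  exists C, forall (S : finType) (M : ctmc R AP S)
    (r : rel S) P m s t (st : store R),
  #|post M s| <= k -> tables M P st -> encodes_rel r st ->
  imem st 26 0 = #|post M s| -> imem st 30 0 = enum_rank s -> imem st 31 0 = enum_rank t ->
  (forall i, i < #|post M s| -> imem st 28 i = bit m i) ->
  runs C (pinned_cmd tr) st (fun st' => rmem st' 1 0 =
    \sum_(0 <= i < #|post M s| | bit m i && ~~ orient tr r (succ_state M s i) t)
      rate M s (succ_state M s i))%R.
Proof.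
eexists => S M r P m s t st dk tab rel st26 st30 st31 st28.
apply: runs_seq_rset.
pose I j (st' : store R) := rmem st' 1 0 =
    (\sum_(0 <= i < j | bit m i && ~~ orient tr r (succ_state M s i) t)
      rate M s (succ_state M s i))%R.
apply: (runs_for (I := I) dk) => //.
  by rewrite /I /= /upd /= big_geq.
move=> j st1 ltj Ij st16 ag.
have [fi fr] := ag.
have tab1 : tables M P st1.
  by apply: (tables_agrees ag) => //; apply: tables_rset.
have rel1 : encodes_rel r st1 by apply: (encodes_rel_agrees ag).
have succE : ieval st1 (succ_cell 30 16) = enum_rank (succ_state M s j).
  exact: (succ_cellE tab1 (etrans (fi 30 0 isT) st30) st16 ltj).
have condE : ieval st1 (rel_cell tr (succ_cell 30 16) (ivar 31)) =
    orient tr r (succ_state M s j) t.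
  exact: (rel_cellE (y := ivar 31) tr tab1 rel1 succE (etrans (fi 31 0 isT) st31)).
have rateE : reval st1 (rate_cell (ivar 30) (succ_cell 30 16)) =
    rate M s (succ_state M s j).
  exact: (rate_cellE (x := ivar 30) tab1 (etrans (fi 30 0 isT) st30) succE).
have bitE : ieval st1 (IGet 28 (ivar 16)) = bit m j by rewrite /= st16 fi // st28.
apply: runs_if => [|nb].
  rewrite -[beval _ _]/(beval st1 (positive _) && ~~ beval st1 (positive _)).
  rewrite (positiveE bitE) (positiveE condE) => b1; apply: runs_rset.
  rewrite /I sum_nat_recr_cond b1 -rateE -[X in (X + _)%R]Ij.
  by [].
apply: runs_skip; move: nb.
rewrite -[beval _ _]/(beval st1 (positive _) && ~~ beval st1 (positive _)).
rewrite (positiveE bitE) (positiveE condE) => /negPf b0.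
by rewrite /I sum_nat_recr_cond b0 addr0; exact: Ij.
Qed.

Lemma matching_runs k tr :
  exists C, forall (S : finType) (M : ctmc R AP S)
    (r : rel S) P m s t (st : store R),
  #|post M s| <= k -> #|post M t| <= k -> tables M P st -> encodes_rel r st ->
  imem st 26 0 = #|post M s| -> imem st 27 0 = #|post M t| ->
  imem st 30 0 = enum_rank s -> imem st 31 0 = enum_rank t ->
  (forall i, i < #|post M s| -> imem st 28 i = bit m i) ->
  runs C (matching_cmd tr) st (fun st' => rmem st' 2 0 =
    \sum_(0 <= j < #|post M t| |
       has (fun i => bit m i && orient tr r (succ_state M s i) (succ_state M t j))
           (iota 0 #|post M s|))
      rate M t (succ_state M t j))%R.
Proof.
eexists => S M r P m s t st dk dk' tab rel st26 st27 st30 st31 st28.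
apply: runs_seq_rset.
pose hit j i := bit m i && orient tr r (succ_state M s i) (succ_state M t j).
pose I j (st' : store R) := rmem st' 2 0 =
    (\sum_(0 <= j' < j | has (hit j') (iota 0 #|post M s|))
      rate M t (succ_state M t j'))%R.
apply: (runs_for (I := I) dk') => //.
  by rewrite /I /= /upd /= big_geq.
move=> j st1 ltj Ij st17 ag.
have [fi fr] := ag.
have tab1 : tables M P st1.
  by apply: (tables_agrees ag) => //; apply: tables_rset.
have rel1 : encodes_rel r st1 by apply: (encodes_rel_agrees ag).
have succtE : ieval st1 (succ_cell 31 17) = enum_rank (succ_state M t j).
  exact: (succ_cellE tab1 (etrans (fi 31 0 isT) st31) st17 ltj).
apply: runs_seq_iset; set st2 := iset st1 _ _ _.
have tab2 : tables M P st2 by apply: tables_iset.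
pose I2 i (st' : store R) := imem st' 25 0 = has (hit j) (iota 0 i).
apply: (runs_seq (P := fun st' => imem st' 25 0 = has (hit j) (iota 0 #|post M s|))).
  apply: (runs_for (I := I2) dk) => //.
    by rewrite /st2 /= /upd /= fi.
  move=> i st3 lti Ii st16 ag3.
  have [fi3 fr3] := ag3.
  have tab3 : tables M P st3 by apply: (tables_agrees ag3).
  have rel3 : encodes_rel r st3 by apply: (encodes_rel_agrees ag3).
  have bitE : ieval st3 (IGet 28 (ivar 16)) = bit m i.
    by rewrite /= st16 fi3 // /st2 /= /upd /= fi // st28.
  have succsE : ieval st3 (succ_cell 30 16) = enum_rank (succ_state M s i).
    apply: (succ_cellE tab3 _ st16 lti).
    exact: (etrans (fi3 30 0 isT) (etrans (fi 30 0 isT) st30)).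
  have succtE3 : ieval st3 (succ_cell 31 17) = enum_rank (succ_state M t j).
    apply: (succ_cellE tab3 _ _ ltj).
      exact: (etrans (fi3 31 0 isT) (etrans (fi 31 0 isT) st31)).
    exact: (etrans (fi3 17 0 isT) st17).
  have condE := rel_cellE tr tab3 rel3 succsE succtE3.
  have recr : has (hit j) (iota 0 i.+1) = has (hit j) (iota 0 i) || hit j i.
    by rewrite -addn1 iotaD has_cat /= orbF.
  apply: runs_if => [|nb].
    rewrite -[beval _ _]/(beval st3 (positive _) && beval st3 (positive _)).
    rewrite (positiveE bitE) (positiveE condE) -/(hit j i) => b1; apply: runs_iset.
    by rewrite /I2 recr b1 orbT.
  apply: runs_skip; move: nb.
  rewrite -[beval _ _]/(beval st3 (positive _) && beval st3 (positive _)).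
  rewrite (positiveE bitE) (positiveE condE) -/(hit j i) => /negPf b0.
  by rewrite /I2 recr b0 orbF; exact: Ii.
move=> st3 flag ag3.
have [fi3 fr3] := ag3.
have tab3 : tables M P st3 by apply: (tables_agrees ag3).
have rateE : reval st3 (rate_cell (ivar 31) (succ_cell 31 17)) =
    rate M t (succ_state M t j).
  have st31' := etrans (fi3 31 0 isT) (etrans (fi 31 0 isT) st31).
  apply: (rate_cellE (x := ivar 31) tab3 st31').
  exact: (succ_cellE tab3 st31' (etrans (fi3 17 0 isT) st17) ltj).
have flagE : ieval st3 (ivar 25) = has (hit j) (iota 0 #|post M s|) by [].
have acc : rmem st3 2 0 = rmem st1 2 0 by rewrite fr3.
apply: runs_if => [|nb].
  rewrite (positiveE flagE) => b1; apply: runs_rset.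
  rewrite /I sum_nat_recr_cond b1 -rateE -[X in (X + _)%R]Ij -acc.
  by [].
apply: runs_skip; move: nb; rewrite (positiveE flagE) => /negPf b0.
by rewrite /I sum_nat_recr_cond b0 addr0 -[RHS]Ij -acc.
Qed.

(** Bits from the out-degree on are ignored, so one range of masks serves all states. *)
Definition subset_of (S : finType) (M : ctmc R AP S) s m : {set S} :=
  [set u in post M s | bit m (index u (enum (post M s)))]%SET.

Lemma subset_of_sub (S : finType) (M : ctmc R AP S) s m : subset_of M s m \subset post M s.
Proof. by apply/fintype.subsetP => u; rewrite inE => /andP[]. Qed.

Lemma subset_of_surj (S : finType) (M : ctmc R AP S) P s (A : {set S}) :
  2 ^ #|post M s| <= P -> A \subset post M s -> exists2 m, m < P & subset_of M s m = A.
Proof.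
move=> leP sub.
have [m ltm mb] := bits_surj #|post M s| (fun i => succ_state M s i \in A).
exists m; first exact: leq_trans ltm leP.
apply/setP => u; rewrite inE; apply/idP/idP.
  move=> /andP[up]; rewrite mb /succ_state ?nth_index ?mem_enum //.
  by rewrite cardE index_mem mem_enum.
move=> uA; have up := fintype.subsetP sub _ uA; rewrite up mb.
  by rewrite /succ_state nth_index ?mem_enum.
by rewrite cardE index_mem mem_enum.
Qed.

Lemma succ_state_post (S : finType) (M : ctmc R AP S) s i :
  i < #|post M s| -> succ_state M s i \in post M s.
Proof. by rewrite cardE => lti; rewrite -mem_enum mem_nth. Qed.

Lemma mem_subset_of (S : finType) (M : ctmc R AP S) s m i :
  i < #|post M s| -> (succ_state M s i \in subset_of M s m) = bit m i.
Proof.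
move=> lti; rewrite inE succ_state_post //= /succ_state index_uniq ?enum_uniq //.
by rewrite -cardE.
Qed.

Lemma sum_post (S : finType) (M : ctmc R AP S) s (Q : pred S) (F : S -> R) :
  (\sum_(u in post M s | Q u) F u =
   \sum_(0 <= i < #|post M s| | Q (succ_state M s i)) F (succ_state M s i))%R.
Proof. by rewrite -big_enum_cond /= (big_nth s) -cardE. Qed.

Lemma pinned_rateE (S : finType) (M : ctmc R AP S) (r : rel S) s t m :
  pinned_rate M r s t (subset_of M s m) =
  (\sum_(0 <= i < #|post M s| | bit m i && ~~ r (succ_state M s i) t)
     rate M s (succ_state M s i))%R.
Proof.
transitivity (\sum_(u in post M s | (u \in subset_of M s m) && ~~ r u t) rate M s u)%R.
  by apply: eq_bigl => u; rewrite inE; case: (u \in post M s).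
rewrite sum_post big_nat_cond [RHS]big_nat_cond; apply: eq_bigl => i.
by apply: andb_id2l => /andP[_ lti]; rewrite mem_subset_of.
Qed.

Lemma matching_rateE (S : finType) (M : ctmc R AP S) (r : rel S) s t m :
  matching_rate M r t (subset_of M s m) =
  (\sum_(0 <= j < #|post M t| |
      has (fun i => bit m i && r (succ_state M s i) (succ_state M t j))
        (iota 0 #|post M s|))
     rate M t (succ_state M t j))%R.
Proof.
rewrite /matching_rate sum_post; apply: eq_bigl => j.
apply/existsP/hasP => [[u /andP[uA ruj]]|[i]].
  move: (uA); rewrite inE => /andP[up ub].
  have ltu : index u (enum (post M s)) < #|post M s|.
    by rewrite cardE index_mem mem_enum.
  exists (index u (enum (post M s))); first by rewrite mem_iota.
  by rewrite ub /succ_state nth_index ?mem_enum.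
rewrite mem_iota => lti /andP[bi ri]; exists (succ_state M s i).
by rewrite mem_subset_of // bi.
Qed.

Lemma side_runs k tr :
  exists C, forall (S : finType) (M : ctmc R AP S)
    (r : rel S) P m s t (st : store R),
  #|post M s| <= k -> #|post M t| <= k -> tables M P st -> encodes_rel r st -> m < P ->
  imem st 30 0 = enum_rank s -> imem st 31 0 = enum_rank t -> imem st 32 0 = m ->
  runs C (side_cmd tr) st (fun st' =>
    rmem st' 1 0 = pinned_rate M (orient tr r) s t (subset_of M s m) /\
    rmem st' 2 0 = matching_rate M (orient tr r) t (subset_of M s m)).
Proof.
have [C1 unpack] := unpack_runs k; have [C2 pinned] := pinned_runs k tr.
have [C3 matching] := matching_runs k tr.
eexists => S M r P m s t st ks kt tab rel mP st30 st31 st32.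
apply: runs_seq_iset; apply: runs_seq_iset.
set st1 := iset (iset _ _ _ _) _ _ _.
have tab1 : tables M P st1 by apply: tables_iset => //; apply: tables_iset.
have d1 : imem st1 26 0 = #|post M s|.
  by rewrite /st1 /= /upd /= st30 (table_deg tab).
have d2 : imem st1 27 0 = #|post M t|.
  by rewrite /st1 /= /upd /= st31 (table_deg tab).
apply: runs_seq.
  by apply: (unpack #|post M s| m P) => // x; [apply: (table_half tab1)|apply: (table_odd tab1)].
move=> st2 bits ag2; have [fi2 _] := ag2.
have tab2 : tables M P st2 by apply: (tables_agrees ag2).
have rel2 : encodes_rel r st2 by apply: (encodes_rel_agrees ag2).
apply: runs_seq.
  by apply: (pinned _ M r P m s t) => //; rewrite fi2.
move=> st3 pin ag3; have [fi3 fr3] := ag3.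
have tab3 : tables M P st3 by apply: (tables_agrees ag3).
have rel3 : encodes_rel r st3 by apply: (encodes_rel_agrees ag3).
apply: (runs_weaken (leqnn _) _ (runs_agrees (matching _ M r P m s t st3 _ _ _ _ _ _ _ _ _))) => //.
- move=> st4 [mat [_ fr4]]; rewrite mat fr4 // pin.
  by rewrite pinned_rateE matching_rateE.
- by rewrite fi3 // fi2.
- by rewrite fi3 // fi2.
- by rewrite fi3 // fi2.
- by rewrite fi3 // fi2.
- by move=> i lti; rewrite fi3 // bits.
Qed.

Definition mem_rel (S : finType) (Rel : {set S * S}) : rel S := fun u v => (u, v) \in Rel.

Definition mask_test (S : finType) (M : ctmc R AP S) (Rel : {set S * S}) s t mA mB : bool :=
  subset_test M (mem_rel Rel) s t (subset_of M s mA) (subset_of M t mB).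

(** Masks below [P] reach all subsets of both successor sets; surplus masks merely repeat
    subsets. *)
Lemma mask_testP (S : finType) (M : ctmc R AP S) (Rel : {set S * S}) s t P :
  2 ^ #|post M s| <= P -> 2 ^ #|post M t| <= P ->
  all (fun mA => all (mask_test M Rel s t mA) (iota 0 P)) (iota 0 P) =
  `[< weak_step M Rel s t >].
Proof.
move=> sP tP; apply/allP/asboolP => [test|/weak_stepP test mA _]; last first.
  by apply/allP => mB _; apply: test; apply: subset_of_sub.
apply/weak_stepP => A B sA sB.
have [mA ltA <-] := subset_of_surj sP sA; have [mB ltB <-] := subset_of_surj tP sB.
have inA : mA \in iota 0 P by rewrite mem_iota.
by have /allP := test _ inA; apply; rewrite mem_iota.
Qed.

Lemma check_runs k :
  exists C, forall (S : finType) (M : ctmc R AP S)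
    (Rel : {set S * S}) P s t (st : store R),
  (forall u, #|post M u| <= k) -> P <= 2 ^ k ->
  tables M P st -> encodes_rel (mem_rel Rel) st ->
  imem st 11 0 = enum_rank s -> imem st 12 0 = enum_rank t ->
  runs C check_cmd st (fun st' => imem st' 21 0 = `[< weak_step M Rel s t >]).
Proof.
have [C1 side1] := side_runs k false; have [C2 side2] := side_runs k true.
eexists => S M Rel P s t st degk Pk tab rel st11 st12.
apply: runs_seq_iset.
pose row mA := all (mask_test M Rel s t mA) (iota 0 P).
pose I j (st' : store R) := imem st' 21 0 = all row (iota 0 j).
(* Both mask loops are charged for [2 ^ k] rounds, whatever [P] is. *)
apply: (runs_for (I := I) Pk) => //.
- exact: table_masks tab.
- move=> jA st1 ltA Ij st14 ag; have [fi fr] := ag.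
  pose I2 j (st' : store R) :=
    imem st' 21 0 = all row (iota 0 jA) && all (mask_test M Rel s t jA) (iota 0 j).
  have recr (p : pred nat) j : all p (iota 0 j.+1) = all p (iota 0 j) && p j.
    by rewrite -addn1 iotaD all_cat /= andbT.
  apply: (runs_for (I := I2) Pk) => //.
  + by rewrite fi //; exact: (table_masks tab).
  + by rewrite /I2 /= andbT; exact: Ij.
  + move=> jB st2 ltB Ij2 st15 ag2; have [fi2 fr2] := ag2.
    do 3!apply: runs_seq_iset.
    set st3 := iset (iset _ _ _ _) _ _ _.
    have tab1 : tables M P st1.
      by apply: (tables_agrees ag) => //; apply: tables_iset.
    have tab2 : tables M P st2 by apply: (tables_agrees ag2).
    have tab3 : tables M P st3 by do 3!(apply: tables_iset => //).
    have rel2 : encodes_rel (mem_rel Rel) st2.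
      by apply: (encodes_rel_agrees ag2) => //; apply: (encodes_rel_agrees ag).
    have s2 : imem st2 11 0 = enum_rank s by rewrite fi2 // fi.
    have t2 : imem st2 12 0 = enum_rank t by rewrite fi2 // fi.
    have mA2 : imem st2 14 0 = jA by rewrite fi2.
    apply: runs_seq.
      by apply: (side1 _ M (mem_rel Rel) P jA s t st3).
    move=> st4 [pin mat] ag4; have [fi4 fr4] := ag4.
    apply: runs_seq_rset; apply: runs_seq_rset.
    do 3!apply: runs_seq_iset.
    set st5 := iset _ _ _ _.
    have tab4 : tables M P st4 by apply: (tables_agrees ag4).
    have tab5 : tables M P st5.
      by do 3!(apply: tables_iset => //); do 2!(apply: tables_rset => //).
    have rel4 : encodes_rel (mem_rel Rel) st4 by apply: (encodes_rel_agrees ag4).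
    have s5 : imem st5 31 0 = enum_rank s by rewrite /st5 /= /upd /= fi4.
    have t5 : imem st5 30 0 = enum_rank t by rewrite /st5 /= /upd /= fi4.
    have mB5 : imem st5 32 0 = jB by rewrite /st5 /= /upd /= fi4.
    apply: runs_seq.
      by apply: (side2 _ M (mem_rel Rel) P jB t s st5).
    move=> st6 [pin' mat'] ag6; have [fi6 fr6] := ag6.
    have p3 : rmem st6 3 0 = pinned_rate M (mem_rel Rel) s t (subset_of M s jA).
      by rewrite fr6.
    have m4 : rmem st6 4 0 = matching_rate M (mem_rel Rel) t (subset_of M s jA).
      by rewrite fr6.
    have ok6 : imem st6 21 0 = all row (iota 0 jA) && all (mask_test M Rel s t jA) (iota 0 jB).
      by rewrite fi6 //; exact: etrans (fi4 21 0 isT) Ij2.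
    apply: runs_if => [|nb].
      rewrite /= p3 m4 pin' mat' => b1; apply: runs_skip.
      by rewrite /I2 recr {2}/mask_test /subset_test b1 andbT; exact: ok6.
    apply: runs_iset; move: nb; rewrite /= p3 m4 pin' mat' => /negPf b0.
    by rewrite /I2 recr {2}/mask_test /subset_test b0 !andbF.
  + by move=> st2 I2P _; rewrite /I recr; exact: I2P.
- by move=> st1 IP _; rewrite -(mask_testP Rel (table_pow tab s) (table_pow tab t)).
Qed.

(** * Deleting pairs *)

Lemma eqn_table_index n x y x' y' :
  y < n -> y' < n -> (x * n + y == x' * n + y') = (x == x') && (y == y').
Proof.
move=> ltn_y ltn_y'; have n_gt0 : 0 < n by apply: leq_ltn_trans ltn_y.
apply/eqP/andP => [e|[/eqP-> /eqP->]//].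
have := congr1 (divn^~ n) e; have := congr1 (modn^~ n) e.
by rewrite /= !modnMDl !divnMDl // !modn_small // !divn_small // !addn0 => -> ->.
Qed.

Lemma state_index_inj (S : finType) (u v s t : S) :
  (state_index u v == state_index s t) = ((u, v) == (s, t)).
Proof.
apply/idP/eqP => [|[-> ->]]; last exact: eqxx.
rewrite /state_index (eqn_table_index _ _ (ltn_ord _) (ltn_ord _)).
by move=> /andP[/eqP/ord_inj/enum_rank_inj -> /eqP/ord_inj/enum_rank_inj ->].
Qed.

Lemma enum_rank_surj (S : finType) j : j < #|S| -> exists s : S, enum_rank s = j :> nat.
Proof. by move=> lt; exists (enum_val (Ordinal lt)); rewrite enum_valK. Qed.

Definition prune (S : finType) (M : ctmc R AP S) (Rel : {set S * S}) s t : {set S * S} :=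
  if ((s, t) \in Rel) && ~~ `[< weak_step M Rel s t >] then Rel :\ (s, t) else Rel.

Lemma prune_runs k :
  exists C, forall (S : finType) (M : ctmc R AP S)
    (Rel : {set S * S}) P s t (st : store R),
  (forall u, #|post M u| <= k) -> P <= 2 ^ k ->
  tables M P st -> encodes_rel (mem_rel Rel) st ->
  imem st 11 0 = enum_rank s -> imem st 12 0 = enum_rank t ->
  runs C prune_cmd st (encodes_rel (mem_rel (prune M Rel s t))).
Proof.
have [C1 check] := check_runs k.
eexists => S M Rel P s t st degk Pk tab rel s0 t0.
have cellE : ieval st (IGet 2 (table_index (ivar 11) (ivar 12))) = ((s, t) \in Rel).
  exact: (rel_cellE (x := ivar 11) (y := ivar 12) false tab rel s0 t0).
apply: runs_if => [|ns]; last first.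
  apply: runs_skip; move: ns; rewrite (positiveE cellE) => /negPf ns.
  by rewrite /prune ns.
rewrite (positiveE cellE) => st_in.
apply: runs_seq; first exact: (check _ M Rel P s t).
move=> st1 ok ag; have [fi fr] := ag.
have {}ok : ieval st1 (ivar 21) = `[< weak_step M Rel s t >] by exact: ok.
have rel1 : encodes_rel (mem_rel Rel) st1 by apply: (encodes_rel_agrees ag).
apply: runs_if => [|nok].
  rewrite (positiveE ok) => step; apply: runs_skip.
  by rewrite /prune st_in step.
apply: runs_iset; move: nok; rewrite (positiveE ok) => nok.
rewrite /prune st_in nok => u v.
have -> : ieval st1 (table_index (ivar 11) (ivar 12)) = state_index s t.
  by rewrite /= !fi //= s0 t0 (table_size tab).
rewrite /= /upd /= state_index_inj rel1 /mem_rel [in RHS]in_setD1.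
by case: eqP.
Qed.

(** As long as nothing has been deleted, all tests of the pass refer to the same relation [Rel0], so
    an uneventful pass certifies all its pairs. After a deletion only the strict decrease is
    remembered. *)
Definition pass_invariant (S : finType) (M : ctmc R AP S) (Rel0 Rel : {set S * S})
    (visited : rel S) : Prop :=
  [/\ weak_preorder M \subset Rel, Rel \subset Rel0 &
      (Rel = Rel0 /\ forall u v, visited u v -> (u, v) \in Rel0 -> weak_step M Rel0 u v) \/
      #|Rel| < #|Rel0|].

(** A pair of the preorder has a weak step for the preorder, hence by monotonicity for any larger
    relation, and is never deleted. *)
Lemma pass_invariant_prune (S : finType) (M : ctmc R AP S) (Rel0 Rel : {set S * S})
    (visited visited' : rel S) s t :
  (forall u v, visited' u v -> visited u v \/ (u, v) = (s, t)) ->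
  pass_invariant M Rel0 Rel visited -> pass_invariant M Rel0 (prune M Rel s t) visited'.
Proof.
move=> vis [sub1 sub2 alt]; rewrite /prune.
case: ifPn => [/andP[st_in /asboolPn nstep]|].
  have proper : Rel :\ (s, t) \proper Rel by apply: properD1.
  split.
  - apply/fintype.subsetP => p pW; rewrite finset.in_setD1 (fintype.subsetP sub1) // andbT.
    apply: contra_notN nstep => /eqP p_st; move: pW; rewrite p_st => pW.
    exact: weak_step_mono sub1 (weak_preorder_sim pW).2.
  - by apply: fintype.subset_trans sub2; apply: proper_sub.
  - right; apply: leq_trans (proper_card proper) (subset_leq_card sub2).
rewrite negb_and negbK => st_ok; split=> //.
case: alt => [[eqR ok]|]; [left|by right]; split=> // u v /vis[|[-> ->]]; first exact: ok.
by move=> st_in; move: st_ok; rewrite eqR st_in /= => /asboolP.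
Qed.

Lemma pass_runs k :
  exists C, forall (S : finType) (M : ctmc R AP S)
    (Rel : {set S * S}) P (st : store R),
  (forall u, #|post M u| <= k) -> P <= 2 ^ k ->
  tables M P st -> encodes_rel (mem_rel Rel) st ->
  weak_preorder M \subset Rel ->
  runs (11 + #|S| * ((11 + #|S| * (C + 14)) + 14)) pass_cmd st
    (fun st' => exists2 Rel', encodes_rel (mem_rel Rel') st' &
                              pass_invariant M Rel Rel' (fun _ _ => true)).
Proof.
have [C prune_ok] := prune_runs k.
exists C => S M Rel P st degk Pk tab rel subW.
pose I j (st' : store R) := exists2 Rel', encodes_rel (mem_rel Rel') st' &
  pass_invariant M Rel Rel' (fun u _ => enum_rank u < j).
apply: (runs_for (I := I) (leqnn _)) => //.
- exact: table_size tab.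
- by exists Rel => //; split=> //; left.
- move=> jA st1 ltA [Rel1 rel1 inv1] jA1 ag; have [fi fr] := ag.
  have [s sE] := enum_rank_surj ltA.
  pose I2 j (st' : store R) := exists2 Rel', encodes_rel (mem_rel Rel') st' &
    pass_invariant M Rel Rel'
      (fun u v => (enum_rank u < jA) || (u == s) && (enum_rank v < j)).
  have tab1 : tables M P st1 by apply: (tables_agrees ag) => //; apply: tables_iset.
  apply: (runs_for (I := I2) (leqnn _)) => //.
  + exact: table_size tab1.
  + exists Rel1 => //; case: inv1 => sub1 sub2 alt; split=> //.
    case: alt => [[eqR ok]|]; [left|by right]; split=> // u v.
    by rewrite ltn0 andbF orbF; exact: ok.
  + move=> jB st2 ltB [Rel2 rel2 inv2] jB2 ag2; have [fi2 fr2] := ag2.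
    have [t tE] := enum_rank_surj ltB.
    have tab2 : tables M P st2 by apply: (tables_agrees ag2) => //; apply: tables_iset.
    have s2 : imem st2 11 0 = enum_rank s by rewrite fi2 // sE.
    have t2 : imem st2 12 0 = enum_rank t by rewrite tE.
    apply: runs_weaken (prune_ok _ M Rel2 P s t st2 degk Pk tab2 rel2 s2 t2) => //.
    move=> st3 rel3; exists (prune M Rel2 s t) => //.
    apply: pass_invariant_prune inv2 => u v /orP[->|/andP[us]]; first by left.
    rewrite us ltnS leq_eqVlt => /orP[/eqP|->]; last by left; rewrite orbT.
    by rewrite -tE => /ord_inj/enum_rank_inj ->; right; rewrite (eqP us).
  + move=> st2 [Rel2 rel2 [sub1 sub2 alt]] _; exists Rel2 => //; split=> //.
    case: alt => [[eqR ok]|]; [left|by right]; split=> // u v.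
    rewrite ltnS leq_eqVlt => /orP[/eqP|lt]; last by apply: ok; rewrite lt.
    rewrite -sE => /ord_inj/enum_rank_inj ->; apply: ok.
    by rewrite eqxx ltn_ord orbT.
- move=> st1 [Rel1 rel1 [sub1 sub2 alt]] _; exists Rel1 => //; split=> //.
  case: alt => [[eqR ok]|]; [left|by right]; split=> // u v _.
  exact: ok.
Qed.

Lemma refine_runs k :
  exists C, forall (S : finType) (M : ctmc R AP S)
    (Rel : {set S * S}) P (st : store R),
  (forall u, #|post M u| <= k) -> P <= 2 ^ k ->
  tables M P st -> encodes_rel (mem_rel Rel) st ->
  (forall u v, (u, v) \in Rel = (label M u == label M v)) ->
  runs (7 + (11 + #|S| * #|S| * ((11 + #|S| * ((11 + #|S| * (C + 14)) + 14)) + 14)))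
    refine_cmd st (encodes_preorder M).
Proof.
have [C pass] := pass_runs k.
exists C => S M Rel0 P st degk Pk tab rel lab.
apply: runs_seq_iset; set st0 := iset _ _ _ _.
have tab0 : tables M P st0 by apply: tables_iset.
(* Each pass either finds the preorder or loses a pair. Once reached, the preorder stays, as it is
   also a lower bound. *)
pose I j (st' : store R) := exists2 Rel, encodes_rel (mem_rel Rel) st' &
  [/\ weak_preorder M \subset Rel, Rel \subset Rel0 &
      Rel = weak_preorder M \/ #|Rel| + j <= #|S| * #|S|].
have sim_eq (Rel : {set S * S}) : weak_preorder M \subset Rel -> Rel \subset Rel0 ->
    (forall u v, (u, v) \in Rel -> weak_step M Rel u v) -> Rel = weak_preorder M.
  move=> sub1 sub2 ok; apply/eqP; rewrite finset.eqEsubset sub1 andbT.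
  apply: weak_simulation_sub => u v uv; split; last exact: ok.
  by apply/eqP; rewrite -lab; exact: (fintype.subsetP sub2).
apply: (runs_for (I := I) (leqnn _)) => //.
- by rewrite /st0 /= /upd /= (table_size tab).
- exists Rel0; first by apply: (encodes_rel_agrees (agrees_iset (ws := [:: 8; 10]) [::] _ _ _ _)).
  split=> //; last by right; rewrite addn0 -card_prod max_card.
  apply/fintype.subsetP => -[u v] uv; rewrite lab.
  by have [/eqP] := weak_preorder_sim uv.
- move=> j st1 ltj [Rel1 rel1 [sub1 sub2 alt]] _ ag.
  have tab1 : tables M P st1 by apply: (tables_agrees ag) => //; apply: tables_iset.
  apply: runs_weaken (pass _ M Rel1 P st1 degk Pk tab1 rel1 sub1) => // st2.
  move=> [Rel2 rel2 [subW sub21 alt2]]; exists Rel2 => //; split=> //.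
    exact: fintype.subset_trans sub21 sub2.
  case: alt => [eqW|card].
    by left; apply/eqP; rewrite finset.eqEsubset subW -eqW sub21.
  case: alt2 => [[eq21 ok]|lt]; last by right; apply: leq_trans card; lia.
  by left; rewrite eq21; apply: sim_eq => // u v uv; apply: ok.
- move=> st1 [Rel rel1 [sub1 sub2 alt]] _ u v.
  have eqW : Rel = weak_preorder M.
    case: alt => // card; apply: sim_eq => // u' v'.
    (* After [n ^ 2] losses the relation is empty, hence trivially a weak simulation. *)
    have /eqP : #|Rel| = 0 by lia.
    by rewrite cards_eq0 => /eqP ->; rewrite finset.in_set0.
  by have := rel1 u v; rewrite /mem_rel eqW inE.
Qed.

(** * Initial relation and auxiliary tables *)

Lemma encodes_ctmc_agrees (S : finType) (M : ctmc R AP S) ws rs (st st' : store R) :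
  agrees ws rs st st' -> 0 \notin ws -> 1 \notin ws -> 0 \notin rs ->
  encodes_ctmc M st -> encodes_ctmc M st'.
Proof.
move=> [hi hr] w0 w1 r0 [e1 e2 e3 e4].
by split=> *; rewrite ?hi ?hr.
Qed.

(** [AP] is fixed before [C], so comparing two labels counts as constant time. *)
Lemma init_runs :
  exists C, forall (S : finType) (M : ctmc R AP S)
    (st : store R),
  encodes_ctmc M st ->
  runs (11 + #|S| * ((11 + #|S| * (C + 14)) + 14)) init_cmd st
    (encodes_rel (fun u v => label M u == label M v)).
Proof.
eexists => S M st enc.
pose I j (st' : store R) := forall u v : S, enum_rank u < j ->
  imem st' 2 (state_index u v) = (label M u == label M v).
apply: (runs_for (I := I) (leqnn _)) => //.
- by case: enc.
- move=> jA st1 ltA Ij jA1 ag; have [fi fr] := ag.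
  have [s sE] := enum_rank_surj ltA.
  pose I2 j (st' : store R) := forall u v : S,
    (enum_rank u < jA) || (u == s) && (enum_rank v < j) ->
    imem st' 2 (state_index u v) = (label M u == label M v).
  have enc1 : encodes_ctmc M st1 by apply: (encodes_ctmc_agrees ag).
  apply: (runs_for (I := I2) (leqnn _)) => //.
  + by case: enc1.
  + by move=> u v; rewrite ltn0 andbF orbF; exact: Ij.
  + move=> jB st2 ltB Ij2 jB2 ag2; have [fi2 fr2] := ag2.
    have [t tE] := enum_rank_surj ltB.
    have enc2 : encodes_ctmc M st2 by apply: (encodes_ctmc_agrees ag2).
    have [size2 sizeAP2 lab2 _] := enc2.
    have s2 : imem st2 11 0 = jA by rewrite fi2.
    apply: runs_seq_iset; set st3 := iset _ _ _ _.
    pose same a := imem st2 1 (jA * #|AP| + a) == imem st2 1 (jB * #|AP| + a).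
    pose I3 j (st' : store R) := imem st' 25 0 = all same (iota 0 j).
    apply: (runs_seq (P := I3 #|AP|)).
      apply: (runs_for (I := I3) (leqnn #|AP|)) => //.
      move=> a st4 lta Ia a4 ag4; have [fi4 fr4] := ag4.
      have recr : all same (iota 0 a.+1) = all same (iota 0 a) && same a.
        by rewrite -addn1 iotaD all_cat /= andbT.
      have cell1 : ieval st4 (label_cell 11) = imem st2 1 (jA * #|AP| + a).
        by rewrite /= a4 !fi4 //= /upd /= s2 sizeAP2.
      have cell2 : ieval st4 (label_cell 12) = imem st2 1 (jB * #|AP| + a).
        by rewrite /= a4 !fi4 //= /upd /= jB2 sizeAP2.
      apply: runs_if => [|ne].
        rewrite -[beval _ _]/((ieval st4 (label_cell 11) <= ieval st4 (label_cell 12)) &&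
          (ieval st4 (label_cell 12) <= ieval st4 (label_cell 11))).
        rewrite cell1 cell2 -eqn_leq -/(same a) => same_a; apply: runs_skip.
        by rewrite /I3 recr same_a andbT; exact: Ia.
      apply: runs_iset; move: ne.
      rewrite -[beval _ _]/((ieval st4 (label_cell 11) <= ieval st4 (label_cell 12)) &&
          (ieval st4 (label_cell 12) <= ieval st4 (label_cell 11))).
      rewrite cell1 cell2 -eqn_leq -/(same a) => /negPf ne.
      by rewrite /I3 recr ne andbF.
    move=> st4 flag ag4; have [fi4 fr4] := ag4.
    have sameE : all same (iota 0 #|AP|) = (label M s == label M t).
      apply/allP/eqP => [all_same|eq_lab a].
        apply/setP => a; have := all_same (enum_rank a).
        rewrite mem_iota ltn_ord => /(_ isT); rewrite /same -sE -tE !lab2.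
        by case: (a \in _); case: (a \in _).
      rewrite mem_iota => /enum_rank_surj[b <-].
      by rewrite /same -sE -tE !lab2 eq_lab.
    apply: runs_iset => u v uv.
    have -> : ieval st4 (table_index (ivar 11) (ivar 12)) = state_index s t.
      by rewrite /= !fi4 //= /upd /= s2 jB2 size2 /state_index sE tE.
    rewrite /= /upd /= state_index_inj; case: eqP => [[-> ->]|ne].
      by rewrite [LHS]flag sameE.
    rewrite fi4 //; apply: Ij2; case/orP: uv => [->//|/andP[us]].
    rewrite us ltnS leq_eqVlt => /orP[/eqP|->]; last by rewrite orbT.
    by rewrite -tE => /ord_inj/enum_rank_inj vt; case: ne; rewrite vt (eqP us).
  + move=> st2 I2n _ u v; rewrite ltnS leq_eqVlt => /orP[/eqP|lt].
      by rewrite -sE => /ord_inj/enum_rank_inj us; apply: I2n; rewrite us eqxx ltn_ord orbT.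
    by apply: I2n; rewrite lt.
- by move=> st1 In _ u v; apply: In.
Qed.

Lemma halving_runs N : exists C, forall P (st : store R),
  P <= N -> imem st 7 0 = P ->
  runs C halving_cmd st (fun st' =>
    forall m, m <= P -> imem st' 5 m = m./2 /\ imem st' 6 m = odd m).
Proof.
eexists => P st PN st7.
apply: runs_seq_iset; apply: runs_seq_iset.
pose I j (st' : store R) := forall m, m <= j -> imem st' 5 m = m./2 /\ imem st' 6 m = odd m.
apply: (runs_for (I := I) PN) => //.
  by move=> m; rewrite leqn0 => /eqP ->.
move=> j st1 ltj Ij st13 ag.
have [half_j odd_j] := Ij _ (leqnn j).
apply: runs_seq_iset; apply: runs_iset => m.
rewrite /= /upd /= st13 addn1 half_j odd_j leq_eqVlt => /predU1P[->|ltm].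
  by rewrite eqxx /= uphalf_half addnC; case: (odd j).
by rewrite ltn_eqF //; apply: Ij.
Qed.

Lemma enum_post (S : finType) (M : ctmc R AP S) s :
  [seq t <- enum S | t \in post M s] = enum (post M s).
Proof. by rewrite [in RHS]/enum_mem -enumT. Qed.

Definition adjacent (S : finType) (M : ctmc R AP S) s (st : store R) : Prop :=
  forall i, i < #|post M s| ->
    imem st 4 (enum_rank s * #|S| + i) = enum_rank (succ_state M s i).

Lemma adjacency_runs k :
  exists C, forall (S : finType) (M : ctmc R AP S)
    (st : store R),
  (forall u, #|post M u| <= k) -> encodes_ctmc M st ->
  runs (3 + (11 + #|S| * ((C + #|S| * C) + 14))) adjacency_cmd st (fun st' =>
    [/\ forall s : S, imem st' 3 (enum_rank s) = #|post M s|,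
        forall s, adjacent M s st',
        forall s, 2 ^ #|post M s| <= imem st' 7 0 & imem st' 7 0 <= 2 ^ k]).
Proof.
exists 100 => S M st degk enc.
apply: runs_seq_iset; set st0 := iset _ _ _ _.
pose I j (st' : store R) :=
  (forall s : S, enum_rank s < j -> [/\ imem st' 3 (enum_rank s) = #|post M s|,
     adjacent M s st' & 2 ^ #|post M s| <= imem st' 7 0]) /\ 1 <= imem st' 7 0 <= 2 ^ k.
apply: (runs_for (I := I) (leqnn _)) => //.
- by case: enc.
- by rewrite /I /= /upd /= expn_gt0.
- move=> j st1 ltj [I1 I2] j1 ag; have [fi fr] := ag.
  have [s sE] := enum_rank_surj ltj.
  have enc1 : encodes_ctmc M st1 by apply: (encodes_ctmc_agrees ag).
  have [size1 _ _ rate1] := enc1.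
  (* The successors among the first [i] states, in the order of [enum (post M s)], which is the
     numbering used by [succ_state]. *)
  pose F i := [seq t <- take i (enum S) | t \in post M s].
  (* The next free position stays within the row of [s], so finished rows are not overwritten. *)
  have sizeF i : i < #|S| -> size (F i) < #|S|.
    move=> lti; apply: leq_ltn_trans lti; rewrite size_filter.
    by apply: leq_trans (count_size _ _) _; rewrite size_take;
      case: ifP => // /negbT; rewrite -leqNgt.
  have Fn : F #|S| = enum (post M s) by rewrite /F cardT take_size enum_post.
  pose I3 i (st' : store R) := [/\ imem st' 22 0 = size (F i),
    imem st' 23 0 = 2 ^ size (F i),
    forall i', i' < size (F i) ->
      imem st' 4 (j * #|S| + i') = enum_rank (nth s (F i) i') &
    forall u : S, enum_rank u < j -> adjacent M u st'].
  (* Here 45 and 12 are rounded-up costs of the two conditionals; the total [34 + 59 * n] fits into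
     [100 + n * 100]. *)
  apply: (@runs_weaken _ (3 + (3 + ((11 + #|S| * (45 + 14)) + (5 + 12))))
    _ _ _ _ _ _ (fun _ h => h)).
    by lia.
  do 2!apply: runs_seq_iset.
  set st2 := iset (iset _ _ _ _) _ _ _.
  apply: (runs_seq (P := I3 #|S|)).
    apply: (runs_for (I := I3) (leqnn _)) => //.
    + have F0 : F 0 = [::] by rewrite /F take0.
      split; rewrite ?F0 //.
      by move=> u ltu; have [] := I1 u ltu.
    + move=> i st3 lti [d3 p3 row3 adj3] i3 ag3; have [fi3 fr3] := ag3.
      have [t tE] := enum_rank_surj lti.
      have Fi : F i.+1 = if t \in post M s then rcons (F i) t else F i.
        rewrite /F (take_nth t) -?cardT // filter_rcons.
        suff -> : nth t (enum S) i = t by [].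
        by rewrite -tE nth_enum_rank.
      have rateE : reval st3 (rate_cell (ivar 11) (ivar 12)) = rate M s t.
        rewrite /= i3 !fi3 //= fr3 //= /upd /= j1 size1 -sE -tE.
        exact: rate1.
      have s3 : imem st3 11 0 = j by rewrite fi3.
      have size3 : imem st3 0 0 = #|S| by rewrite fi3.
      apply: (@runs_weaken _ _ _ _ _ _ _ _ (fun _ h => h)); last first.
        apply: runs_if => [|pos].
          rewrite -[beval _ _]/(reval st3 (rate_cell (ivar 11) (ivar 12)) <= 0)%R rateE => le0.
          apply: runs_skip; rewrite /I3 Fi.
          by have -> : (t \in post M s) = false by rewrite inE ltNge le0.
        move: pos.
        rewrite -[beval _ _]/(reval st3 (rate_cell (ivar 11) (ivar 12)) <= 0)%R.
        rewrite rateE => pos.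
        have tp : t \in post M s by rewrite inE ltNge.
        do 2!apply: runs_seq_iset; apply: runs_iset.
        rewrite /I3 Fi tp size_rcons /= /upd /= d3 p3 s3 size3 i3.
        split.
        * by rewrite addn1.
        * by rewrite expnS mul2n addnn.
        * move=> i' lti'; rewrite eqn_add2l nth_rcons.
          move: lti'; rewrite ltnS leq_eqVlt => /predU1P[->|lti'].
            by rewrite !eqxx ltnn tE.
          by rewrite (ltn_eqF lti') lti' row3.
        * move=> u ltu i' lti'; rewrite /= /upd /=.
          rewrite eqn_table_index ?sizeF //; last first.
            by apply: leq_trans lti' (max_card _).
          by rewrite (ltn_eqF ltu) /=; apply: adj3.
      by [].
  move=> st3 [d3 p3 row3 adj3] [fi3 fr3].
  apply: runs_seq_iset.
  have s3 : imem st3 11 0 = j by rewrite fi3.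
  have P3 : imem st3 7 0 = imem st1 7 0 by rewrite fi3.
  move: d3 p3 row3; rewrite Fn -cardE => d3 p3 row3.
  set st4 := iset _ _ _ _.
  have deg4 (u : S) : enum_rank u < j.+1 -> imem st4 3 (enum_rank u) = #|post M u|.
    rewrite /st4 /= /upd /= s3 ltnS leq_eqVlt => /predU1P[uj|ltu].
      by rewrite uj eqxx d3; move: uj; rewrite -sE => /ord_inj/enum_rank_inj ->.
    by rewrite (ltn_eqF ltu) fi3 //; have [] := I1 u ltu.
  have adj4 (u : S) : enum_rank u < j.+1 -> adjacent M u st4.
    rewrite ltnS leq_eqVlt => /predU1P[uj|ltu]; last exact: adj3.
    move=> i lti; rewrite uj; have us : u = s by apply/enum_rank_inj/ord_inj; rewrite uj.
    by rewrite us in lti *; exact: row3.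
  have P4 : imem st4 7 0 = imem st1 7 0 := P3.
  have p4 : imem st4 23 0 = 2 ^ #|post M s| := p3.
  have [P1 Pk] := andP I2.
  apply: (@runs_weaken _ _ _ _ _ _ _ _ (fun _ h => h)); last first.
    have condE : beval st4 (BIle (ivar 23) (ivar 7)) = (2 ^ #|post M s| <= imem st1 7 0).
      by rewrite -p4 -P4.
    apply: runs_if => cmp; [apply: runs_skip|apply: runs_iset]; move: cmp;
      rewrite condE.
    + move=> leP; split; last by rewrite /= /upd /= P3.
      move=> u ltu; split; [exact: deg4|exact: adj4|].
      rewrite /= /upd /= P3; move: ltu; rewrite ltnS leq_eqVlt => /predU1P[|ltu].
        by rewrite -sE => /ord_inj/enum_rank_inj ->.
      by have [] := I1 u ltu.
    + rewrite -ltnNge => /ltnW gtP; split; last first.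
        by rewrite /= /upd /= p3 expn_gt0 /= leq_exp2l.
      move=> u ltu; split; [exact: deg4|exact: adj4|].
      rewrite /= /upd /= p3; move: ltu; rewrite ltnS leq_eqVlt => /predU1P[|ltu].
        by rewrite -sE => /ord_inj/enum_rank_inj ->.
      by have [_ _ h] := I1 u ltu; apply: leq_trans h gtP.
  by [].
- move=> st1 [I1 /andP[_ I2]] _; split=> // s; have [|] := I1 s => //.
Qed.

(** * Total running time *)

Lemma simulation_runs k : exists T : nat -> nat,
  (exists C, forall n, 0 < n -> T n <= C * n ^ 4) /\
  forall (S : finType) (M : ctmc R AP S) (st : store R),
    fanout M <= k -> encodes_ctmc M st ->
    runs (T #|S|) simulation_cmd st (encodes_preorder M).
Proof.
have [C1 init] := init_runs; have [C2 adjacency] := adjacency_runs k.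
have [C3 halving] := halving_runs (2 ^ k); have [C4 refine] := refine_runs k.
exists (fun n => (11 + n * ((11 + n * (C1 + 14)) + 14)) +
  ((3 + (11 + n * ((C2 + n * C2) + 14))) + (C3 +
   (7 + (11 + n * n * ((11 + n * ((11 + n * (C4 + 14)) + 14)) + 14)))))).
split.
  (* The sum of the coefficients of the polynomial; for positive [n] every lower power is at most
     [n ^ 4]. *)
  exists (160 + C1 + 2 * C2 + C3 + C4) => n n_gt0.
  have le_n4 i : i <= 4 -> n ^ i <= n ^ 4 by apply: leq_pexp2l.
  have scale c i : i <= 4 -> c * n ^ i <= c * n ^ 4.
    by move=> le4; rewrite leq_mul2l le_n4 ?orbT.
  have := scale (43 + C3) 0 isT; have := scale (39 + C2) 1 isT.
  have := scale (C1 + 39 + C2) 2 isT; have := scale 25 3 isT.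
  by rewrite !expnS expn0 !muln1; nia.
move=> S M st fan enc.
have degk (u : S) : #|post M u| <= k by apply: leq_trans (leq_bigmax u) fan.
apply: runs_seq; first exact: init enc.
move=> st1 rel1 ag1.
have enc1 : encodes_ctmc M st1 by apply: (encodes_ctmc_agrees ag1).
apply: runs_seq; first exact: adjacency enc1.
move=> st2 [deg2 adj2 pow2 masks2] ag2.
have enc2 : encodes_ctmc M st2 by apply: (encodes_ctmc_agrees ag2).
have rel2 := encodes_rel_agrees ag2 isT rel1.
apply: runs_seq; first exact: (halving _ _ masks2).
move=> st3 half3 ag3; have [fi3 fr3] := ag3.
have [size3 _ _ rate3] := encodes_ctmc_agrees ag3 isT isT isT enc2.
have rel3 := encodes_rel_agrees ag3 isT rel2.
pose Rel0 : {set S * S} := [set p | label M p.1 == label M p.2]%SET.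
apply: (refine _ _ Rel0 (imem st2 7 0)) => //.
- split=> //.
  + by move=> s; rewrite fi3.
  + by move=> s i lti; rewrite fi3 //; apply: adj2.
  + by move=> m /ltnW/half3[].
  + by move=> m /ltnW/half3[].
  + by rewrite fi3.
- by move=> u v; rewrite rel3 /mem_rel inE.
- by move=> u v; rewrite inE.
Qed.

End Program.

Local Open Scope classical_set_scope.
Local Open Scope ring_scope.

Lemma bigO_pow4 (R : realType) (T : nat -> nat) C :
  (forall n, 0 < n -> T n <= C * n ^ 4)%N ->
  (fun n : nat => (T n)%:R : R^o) =O_\oo (fun n : nat => n%:R ^+ 4 : R^o).
Proof.
move=> bound; rewrite eqOP; near=> c; near=> n.
rewrite normrX !normr_nat -natrX.
apply: (@le_trans _ _ (C * n ^ 4)%N%:R).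
  by rewrite ler_nat bound //; near: n; exact: nbhs_infty_gt.
rewrite natrM ler_wpM2r ?ler0n //; near: c; exact: nbhs_pinfty_ge.
Unshelve. all: by end_near.
Qed.

Theorem theorem5p20 (R : realType) (AP : finType) :
  exists prog : cmd,
  forall k : nat, exists T : nat -> nat,
    ((fun n : nat => (T n)%:R : R^o) =O_\oo (fun n : nat => n%:R ^+ 4 : R^o)) /\
    forall (S : finType) (M : ctmc R AP S), (fanout M <= k)%N ->
    forall st : store R, encodes_ctmc M st ->
    exists (t : nat) (st' : store R),
      [/\ exec prog st t st', (t <= T #|S|)%N & encodes_preorder M st'].
Proof.
exists simulation_cmd => k.
have [T [[C bound] run]] := simulation_runs R AP k.
exists T; split; first exact: bigO_pow4 bound.
by move=> S M fan st enc; apply: run.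
Qed.
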